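(* Let $g(x,y)$ be a smooth real-valued function defined in a neighbourhood of $(0,0)\in\mathbb{R}^2$ such that $g(0,0)=g_y(0,0)=0$ and $g_{yy}(0,0)\neq 0$. Then $g$ is an admissible discriminant if and only if there exists a (smooth, local near $(0,0)$) transformation of the second coordinate $\tilde y=\tilde y(x,y)$, with $\frac{\partial\tilde y}{\partial y}\neq 0$, that reduces $g$ to one of the following two forms: either $g=\pm\tilde y^2+\frac{x^2}{4}$ or $g=\pm\tilde y^2$. In the coordinates $(x,\tilde y)$ the corresponding Nijenhuis operators (i.e. the Nijenhuis operators $L$ with $\operatorname{tr}L=x$ and $\left(\frac{\operatorname{tr}L}{2}\right)^2-\det L=g$) are, respectively, $$L_1^{\pm}=\begin{bmatrix} x & \pm 2\tilde y\\ \frac{\tilde y}{2} & 0\end{bmatrix}\qquad\text{and}\qquad L_2^{\pm}=\begin{bmatrix}\frac{x}{2} & \pm 2\tilde y\\ \frac{\tilde y}{2} & \frac{x}{2}\end{bmatrix}.$$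
   Context: Smooth means $C^\infty$; all statements are local, in a (sufficiently small) neighbourhood of the origin. An operator $L$ on an open set of $\mathbb{R}^2$ is a smooth $(1,1)$-tensor field; its matrix in coordinates $(x^1,x^2)$ is $(L^i_j)$ with row index $i$ and column index $j$, so $L\,\partial_{x^j}=\sum_i L^i_j\,\partial_{x^i}$. The Nijenhuis torsion of $L$ is $\mathcal{N}_L(v,u)=[Lv,Lu]+L^2[v,u]-L[Lv,u]-L[v,Lu]$ for smooth vector fields $v,u$, and $L$ is called a Nijenhuis operator if $\mathcal{N}_L\equiv 0$. A function $g(x,y)$ defined near $(0,0)$ is called an admissible discriminant if there exists a smooth Nijenhuis operator $L$ (in a neighbourhood of $(0,0)$) such that $\operatorname{tr}L=x$ and $\left(\frac{\operatorname{tr}L}{2}\right)^2-\det L=g(x,y)$. Subscripts denote partial derivatives. *)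

(* Defs.v *)
From Stdlib Require Import Reals.
From Coquelicot Require Import Coquelicot.
Open Scope R_scope.

(* Functions, vector fields and operators on an open set of the plane are
   represented by total functions of (x, y); every condition on them is
   imposed only at the points of that open set. *)

Definition nbhd_origin (U : R * R -> Prop) : Prop := open U /\ U (0, 0).

Definition Dx (f : R -> R -> R) : R -> R -> R :=
  fun x y => Derive (fun t => f t y) x.

Definition Dy (f : R -> R -> R) : R -> R -> R :=
  fun x y => Derive (fun t => f x t) y.

(* [ex_diff_n f n x y]: all iterated partial derivatives of [f] of order at
   most [n] exist and are continuous at (x, y).  Required for all [n] at all
   points of an open set, this is C^infinity. *)
Definition smooth_on (U : R * R -> Prop) (f : R -> R -> R) : Prop :=
  forall x y : R, U (x, y) -> forall n : nat, ex_diff_n f n x y.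

(* [mij] is the entry in row i and column j. *)
Record mat2 : Type := Mat2 { m11 : R; m12 : R; m21 : R; m22 : R }.

Definition mtrace (A : mat2) : R := m11 A + m22 A.

Definition mdet (A : mat2) : R := m11 A * m22 A - m12 A * m21 A.

Definition mmul (A B : mat2) : mat2 :=
  Mat2 (m11 A * m11 B + m12 A * m21 B) (m11 A * m12 B + m12 A * m22 B)
       (m21 A * m11 B + m22 A * m21 B) (m21 A * m12 B + m22 A * m22 B).

(* Meaningful only when [mdet A <> 0]. *)
Definition minv (A : mat2) : mat2 :=
  Mat2 (m22 A / mdet A) (- m12 A / mdet A)
       (- m21 A / mdet A) (m11 A / mdet A).

Definition mapply (A : mat2) (v : R * R) : R * R :=
  (m11 A * fst v + m12 A * snd v, m21 A * fst v + m22 A * snd v).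

Definition vfield : Type := R -> R -> R * R.

Definition tensor11 : Type := R -> R -> mat2.

Definition smooth_vfield (U : R * R -> Prop) (v : vfield) : Prop :=
  smooth_on U (fun x y => fst (v x y)) /\
  smooth_on U (fun x y => snd (v x y)).

Definition smooth_tensor11 (U : R * R -> Prop) (L : tensor11) : Prop :=
  smooth_on U (fun x y => m11 (L x y)) /\
  smooth_on U (fun x y => m12 (L x y)) /\
  smooth_on U (fun x y => m21 (L x y)) /\
  smooth_on U (fun x y => m22 (L x y)).

Definition act (L : tensor11) (v : vfield) : vfield :=
  fun x y => mapply (L x y) (v x y).

Definition lie_derivative (v : vfield) (f : R -> R -> R) : R -> R -> R :=
  fun x y => fst (v x y) * Dx f x y + snd (v x y) * Dy f x y.

Definition bracket (v u : vfield) : vfield :=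
  fun x y =>
    (lie_derivative v (fun a b => fst (u a b)) x y
       - lie_derivative u (fun a b => fst (v a b)) x y,
     lie_derivative v (fun a b => snd (u a b)) x y
       - lie_derivative u (fun a b => snd (v a b)) x y).

Definition torsion (L : tensor11) (v u : vfield) : vfield :=
  fun x y =>
    minus (minus (plus (bracket (act L v) (act L u) x y)
                       (act L (act L (bracket v u)) x y))
                 (act L (bracket (act L v) u) x y))
          (act L (bracket v (act L u)) x y).

Definition nijenhuis_operator (U : R * R -> Prop) (L : tensor11) : Prop :=
  smooth_tensor11 U L /\
  forall v u : vfield, smooth_vfield U v -> smooth_vfield U u ->
  forall x y : R, U (x, y) -> torsion L v u x y = (0, 0).

Definition nijenhuis_with_discriminant
    (U : R * R -> Prop) (g : R -> R -> R) (L : tensor11) : Prop :=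
  nijenhuis_operator U L /\
  forall x y : R, U (x, y) ->
    mtrace (L x y) = x /\
    (mtrace (L x y) / 2) ^ 2 - mdet (L x y) = g x y.

Definition admissible_discriminant (g : R -> R -> R) : Prop :=
  exists U : R * R -> Prop, nbhd_origin U /\
  exists L : tensor11, nijenhuis_with_discriminant U g L.

Definition second_coordinate_change
    (U : R * R -> Prop) (yt : R -> R -> R) : Prop :=
  smooth_on U yt /\ forall x y : R, U (x, y) -> Dy yt x y <> 0.

Definition jacobian (f1 f2 : R -> R -> R) : tensor11 :=
  fun x y => Mat2 (Dx f1 x y) (Dy f1 x y) (Dx f2 x y) (Dy f2 x y).

(* The matrix of [L] in the coordinates (f1, f2), at the point whose original
   coordinates are (x, y): the columns of the inverse Jacobian matrix are the
   coordinate vector fields of (f1, f2). *)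
Definition matrix_in_coords (f1 f2 : R -> R -> R) (L : tensor11) : tensor11 :=
  fun x y =>
    mmul (mmul (jacobian f1 f2 x y) (L x y)) (minv (jacobian f1 f2 x y)).

(* The sign [s] is 1 or -1; [t] stands for the new second coordinate. *)
Definition normal_form1 (s x t : R) : R := s * t ^ 2 + x ^ 2 / 4.

Definition normal_form2 (s x t : R) : R := s * t ^ 2.

Definition normal_op1 (s x t : R) : mat2 := Mat2 x (s * (2 * t)) (t / 2) 0.

Definition normal_op2 (s x t : R) : mat2 := Mat2 (x / 2) (s * (2 * t)) (t / 2) (x / 2).

(* Main.v *)
(** In dimension two, a Nijenhuis operator [L] with trace [x] and discriminant [g] has first row
    [(x/2 + g_x, g_y)] and lower right entry [x/2 - g_x], and the one remaining condition is
    [g - g_x^2 = g_y c] for the smooth lower left entry [c]. By Morse's lemma with the parameter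
    [x], [g = h(x) + s yt^2], where [h(x)] is the value of [g(x, .)] at its critical point; there
    the condition reads [h = h'^2], whose only smooth solutions with [h(0) = 0] are [0] and
    [x^2/4]. Conversely, when [g] is in normal form, [g_y] vanishes only on the nowhere dense set
    [yt = 0], so [c], hence [L], is unique. *)

Require Import Defs.
From Stdlib Require Import Reals Lra Lia Ranalysis5 ClassicalEpsilon.
From Coquelicot Require Import Coquelicot.
(* [Reals] shadows [Defs.Dx] by [Rderiv.Dx]. *)
Import Defs.
Open Scope R_scope.

(** * Functions of class C^n on an open set *)

(** On the critical curve of [g] in y the product g_y c drops out whatever c is, and the chain rule
    gives h' = g_x there; this is why the condition becomes an equation for h alone. Uniqueness for
    ordinary differential equations does not solve h = h'^2: h' = ±sqrt h is not Lipschitz at 0, and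
    gluing 0 to (x - c)^2/4 at x = c yields further C^1 solutions. Continuity of h'' excludes these,
    so y0 and h must be shown to be smooth and not merely to exist. The other analytic point is that
    Morse's coordinate must be smooth jointly in x and y, including where y = y0(x): the quotients
    by y - y0(x) are therefore defined by integrals and not by division. The two normal forms are
    treated together as s yt^2 + k x^2/4 with k^2 = k. *)

Definition diff_on (U : R * R -> Prop) (n : nat) (f : R -> R -> R) : Prop :=
  forall x y : R, U (x, y) -> ex_diff_n f n x y.

Lemma open_locally_2d (U : R * R -> Prop) (x y : R) :
  open U -> U (x, y) -> locally_2d (fun u v => U (u, v)) x y.
Proof.
  intros HU Hxy. apply locally_2d_locally.
  generalize (HU _ Hxy). apply filter_imp. now intros [u v].
Qed.

Lemma is_derive_mult_R (f g : R -> R) (x df dg : R) :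
  is_derive f x df -> is_derive g x dg ->
  is_derive (fun t => f t * g t) x (df * g x + f x * dg).
Proof. intros Hf Hg. apply (is_derive_mult f g x df dg Hf Hg Rmult_comm). Qed.

Lemma is_derive_plus_R (f g : R -> R) (x df dg : R) :
  is_derive f x df -> is_derive g x dg ->
  is_derive (fun t => f t + g t) x (df + dg).
Proof. intros Hf Hg. apply (is_derive_plus f g x df dg Hf Hg). Qed.

Section DiffOn.

Variable U : R * R -> Prop.
Hypothesis HU : open U.

Lemma diff_on_elim (n : nat) (f : R -> R -> R) :
  diff_on U (S n) f ->
  (forall x y, U (x, y) -> continuity_2d_pt f x y) /\
  (forall x y, U (x, y) -> is_derive (fun t => f t y) x (Dx f x y)) /\
  (forall x y, U (x, y) -> is_derive (fun t => f x t) y (Dy f x y)) /\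
  diff_on U n (Dx f) /\ diff_on U n (Dy f).
Proof.
  intros H. split; [|split; [|split; [|split]]]; intros x y Hxy;
    destruct (H x y Hxy) as (H0 & H1 & H2 & H3 & H4); auto; now apply Derive_correct.
Qed.

Lemma diff_on_ext (n : nat) (f h : R -> R -> R) :
  (forall x y, U (x, y) -> f x y = h x y) -> diff_on U n f -> diff_on U n h.
Proof.
  intros E H x y Hxy. apply ex_diff_n_ext_loc with f; [|now apply H].
  destruct (open_locally_2d U x y HU Hxy) as [d Hd].
  exists d. intros u v Hu Hv. apply E. now apply Hd.
Qed.

(** The induction step for C^n: on an open set the partial derivatives may be replaced by any
    formulas that compute them, since [ex_diff_n] depends only on the germ of a function. *)
Lemma diff_on_intro (n : nat) (f fx fy : R -> R -> R) :
  (forall x y, U (x, y) -> continuity_2d_pt f x y) ->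
  (forall x y, U (x, y) -> is_derive (fun t => f t y) x (fx x y)) ->
  (forall x y, U (x, y) -> is_derive (fun t => f x t) y (fy x y)) ->
  diff_on U n fx -> diff_on U n fy -> diff_on U (S n) f.
Proof.
  intros H0 H1 H2 H3 H4 x y Hxy. split; [|split; [|split; [|split]]].
  - now apply H0.
  - eexists; now apply H1.
  - eexists; now apply H2.
  - revert x y Hxy. change (diff_on U n (Dx f)). apply diff_on_ext with fx; auto.
    intros x y Hxy. symmetry. now apply is_derive_unique, H1.
  - revert x y Hxy. change (diff_on U n (Dy f)). apply diff_on_ext with fy; auto.
    intros x y Hxy. symmetry. now apply is_derive_unique, H2.
Qed.

Lemma diff_on_cont (n : nat) (f : R -> R -> R) :
  diff_on U n f -> forall x y, U (x, y) -> continuity_2d_pt f x y.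
Proof. intros H x y Hxy. generalize (H x y Hxy). destruct n; now intros []. Qed.

Lemma diff_on_le (m n : nat) (f : R -> R -> R) :
  (m <= n)%nat -> diff_on U n f -> diff_on U m f.
Proof. intros Hmn H x y Hxy. eapply ex_diff_n_m; eauto. Qed.

Lemma diff_on_const (n : nat) (c : R) : diff_on U n (fun _ _ => c).
Proof.
  revert c. induction n; intros c.
  - intros x y _. split; auto. apply continuity_2d_pt_const.
  - apply diff_on_intro with (fx := fun _ _ => 0) (fy := fun _ _ => 0); auto; intros x y _.
    + apply continuity_2d_pt_const.
    + apply @is_derive_const.
    + apply @is_derive_const.
Qed.

Lemma diff_on_fst (n : nat) : diff_on U n (fun x _ => x).
Proof.
  destruct n.
  - intros x y _. split; auto. apply continuity_2d_pt_id1.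
  - apply diff_on_intro with (fx := fun _ _ => 1) (fy := fun _ _ => 0);
      try apply diff_on_const; intros x y _.
    + apply continuity_2d_pt_id1.
    + apply @is_derive_id.
    + apply @is_derive_const.
Qed.

Lemma diff_on_snd (n : nat) : diff_on U n (fun _ y => y).
Proof.
  destruct n.
  - intros x y _. split; auto. apply continuity_2d_pt_id2.
  - apply diff_on_intro with (fx := fun _ _ => 0) (fy := fun _ _ => 1);
      try apply diff_on_const; intros x y _.
    + apply continuity_2d_pt_id2.
    + apply @is_derive_const.
    + apply @is_derive_id.
Qed.

Lemma diff_on_plus (n : nat) (f h : R -> R -> R) :
  diff_on U n f -> diff_on U n h -> diff_on U n (fun x y => f x y + h x y).
Proof.
  revert f h. induction n; intros f h Hf Hh.
  - intros x y Hxy. split; auto. apply continuity_2d_pt_plus; eapply diff_on_cont; eauto.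
  - destruct (diff_on_elim _ _ Hf) as (f0 & f1 & f2 & f3 & f4).
    destruct (diff_on_elim _ _ Hh) as (h0 & h1 & h2 & h3 & h4).
    apply diff_on_intro with (fx := fun x y => Dx f x y + Dx h x y)
      (fy := fun x y => Dy f x y + Dy h x y); auto; intros x y Hxy.
    + apply continuity_2d_pt_plus; auto.
    + apply is_derive_plus_R; [now apply f1|now apply h1].
    + apply is_derive_plus_R; [now apply f2|now apply h2].
Qed.

Lemma diff_on_mult (n : nat) (f h : R -> R -> R) :
  diff_on U n f -> diff_on U n h -> diff_on U n (fun x y => f x y * h x y).
Proof.
  revert f h. induction n; intros f h Hf Hh.
  - intros x y Hxy. split; auto. apply continuity_2d_pt_mult; eapply diff_on_cont; eauto.
  - destruct (diff_on_elim _ _ Hf) as (f0 & f1 & f2 & f3 & f4).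
    destruct (diff_on_elim _ _ Hh) as (h0 & h1 & h2 & h3 & h4).
    assert (Hf' : diff_on U n f) by (apply diff_on_le with (S n); auto).
    assert (Hh' : diff_on U n h) by (apply diff_on_le with (S n); auto).
    apply diff_on_intro with (fx := fun x y => Dx f x y * h x y + f x y * Dx h x y)
      (fy := fun x y => Dy f x y * h x y + f x y * Dy h x y);
      try (apply diff_on_plus; apply IHn; assumption); intros x y Hxy.
    + apply continuity_2d_pt_mult; auto.
    + apply (is_derive_mult_R (fun t => f t y) (fun t => h t y)); [now apply f1|now apply h1].
    + apply (is_derive_mult_R (fun t => f x t) (fun t => h x t)); [now apply f2|now apply h2].
Qed.

Lemma diff_on_opp (n : nat) (f : R -> R -> R) :
  diff_on U n f -> diff_on U n (fun x y => - f x y).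
Proof.
  intros Hf. apply diff_on_ext with (fun x y => (-1) * f x y).
  - intros; ring.
  - apply diff_on_mult; auto. apply diff_on_const.
Qed.

Lemma diff_on_minus (n : nat) (f h : R -> R -> R) :
  diff_on U n f -> diff_on U n h -> diff_on U n (fun x y => f x y - h x y).
Proof. intros Hf Hh. apply diff_on_plus; auto. now apply diff_on_opp. Qed.

Lemma diff_on_inv (n : nat) (f : R -> R -> R) :
  (forall x y, U (x, y) -> f x y <> 0) ->
  diff_on U n f -> diff_on U n (fun x y => / f x y).
Proof.
  intros Hnz. induction n; intros Hf.
  - intros x y Hxy. split; auto. apply continuity_2d_pt_inv; auto. eapply diff_on_cont; eauto.
  - destruct (diff_on_elim _ _ Hf) as (f0 & f1 & f2 & f3 & f4).
    assert (Hi : diff_on U n (fun x y => / f x y))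
      by (apply IHn, diff_on_le with (S n); auto).
    (* The derivative is written as a product containing [/ f] itself, so that the induction
       hypothesis covers it. *)
    apply diff_on_intro with (fx := fun x y => - (Dx f x y * (/ f x y * / f x y)))
      (fy := fun x y => - (Dy f x y * (/ f x y * / f x y)));
      try (apply diff_on_opp; repeat apply diff_on_mult; assumption); intros x y Hxy.
    + apply continuity_2d_pt_inv; auto.
    + replace (- (Dx f x y * (/ f x y * / f x y))) with (- Dx f x y / f x y ^ 2) by (field; auto).
      apply (is_derive_inv (fun t => f t y)); auto.
    + replace (- (Dy f x y * (/ f x y * / f x y))) with (- Dy f x y / f x y ^ 2) by (field; auto).
      apply (is_derive_inv (fun t => f x t)); auto.
Qed.

Lemma diff_on_div (n : nat) (f h : R -> R -> R) :
  (forall x y, U (x, y) -> h x y <> 0) ->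
  diff_on U n f -> diff_on U n h -> diff_on U n (fun x y => f x y / h x y).
Proof. intros Hnz Hf Hh. apply diff_on_mult; auto. now apply diff_on_inv. Qed.

Lemma diff_on_sqrt (n : nat) (f : R -> R -> R) :
  (forall x y, U (x, y) -> 0 < f x y) ->
  diff_on U n f -> diff_on U n (fun x y => sqrt (f x y)).
Proof.
  intros Hpos.
  assert (C : forall x y, U (x, y) -> continuity_2d_pt f x y ->
                continuity_2d_pt (fun x y => sqrt (f x y)) x y).
  { intros x y Hxy Hc. apply continuity_1d_2d_pt_comp; auto.
    apply continuity_pt_sqrt. left. auto. }
  induction n; intros Hf.
  - intros x y Hxy. split; auto. apply C; auto. eapply diff_on_cont; eauto.
  - destruct (diff_on_elim _ _ Hf) as (f0 & f1 & f2 & f3 & f4).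
    assert (Hi : diff_on U n (fun x y => / (2 * sqrt (f x y)))).
    { apply diff_on_inv.
      - intros x y Hxy. apply Rgt_not_eq, Rmult_lt_0_compat; [lra|]. now apply sqrt_lt_R0, Hpos.
      - apply diff_on_mult; [apply diff_on_const|]. apply IHn, diff_on_le with (S n); auto. }
    apply diff_on_intro with (fx := fun x y => Dx f x y / (2 * sqrt (f x y)))
      (fy := fun x y => Dy f x y / (2 * sqrt (f x y)));
      try (apply diff_on_mult; assumption); intros x y Hxy.
    + apply C; auto.
    + apply (is_derive_sqrt (fun t => f t y)); auto.
    + apply (is_derive_sqrt (fun t => f x t)); auto.
Qed.

(** Continuity of the partial derivative in x turns the two partial derivatives into a total
    differential, as the chain rule in two variables requires. *)
Lemma diff_on_differentiable (n : nat) (f : R -> R -> R) (x y : R) :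
  diff_on U (S n) f -> U (x, y) ->
  differentiable_pt_lim f x y (Dx f x y) (Dy f x y).
Proof.
  intros Hf Hxy.
  destruct (diff_on_elim _ _ Hf) as (f0 & f1 & f2 & f3 & f4).
  apply filterdiff_differentiable_pt_lim.
  apply (is_derive_filterdiff f x y (Dx f) (Dy f x y)).
  - generalize (HU _ Hxy). apply filter_imp. intros [u v]. apply f1.
  - now apply f2.
  - apply (proj1 (continuity_2d_pt_filterlim (Dx f) x y)). eapply diff_on_cont; eauto.
Qed.

End DiffOn.

Lemma locally_2d_comp (P : R -> R -> Prop) (a b : R -> R -> R) (x y : R) :
  locally_2d P (a x y) (b x y) ->
  continuity_2d_pt a x y -> continuity_2d_pt b x y ->
  locally_2d (fun u v => P (a u v) (b u v)) x y.
Proof.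
  intros [d Hd] Ha Hb.
  apply locally_2d_impl with (2 := locally_2d_and _ _ _ _ (Ha d) (Hb d)).
  apply locally_2d_forall. intros u v [H1 H2]. now apply Hd.
Qed.

Lemma continuity_2d_pt_comp (f a b : R -> R -> R) (x y : R) :
  continuity_2d_pt f (a x y) (b x y) ->
  continuity_2d_pt a x y -> continuity_2d_pt b x y ->
  continuity_2d_pt (fun x y => f (a x y) (b x y)) x y.
Proof. intros Hf Ha Hb eps. apply (locally_2d_comp _ a b x y (Hf eps)); auto. Qed.

(** By the chain rule the partial derivatives of the composite are sums of products of composites
    with the same inner functions [a] and [b]. The induction therefore varies [f] and keeps [a] and
    [b] fixed. *)
Lemma diff_on_comp (U V : R * R -> Prop) (n : nat) (f a b : R -> R -> R) :
  open U -> open V -> (forall x y, U (x, y) -> V (a x y, b x y)) ->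
  diff_on V n f -> diff_on U n a -> diff_on U n b ->
  diff_on U n (fun x y => f (a x y) (b x y)).
Proof.
  intros HU HV HUV. revert f. induction n; intros f Hf Ha Hb.
  - intros x y Hxy. split; auto.
    apply continuity_2d_pt_comp; [apply (diff_on_cont V 0)|apply (diff_on_cont U 0)|apply (diff_on_cont U 0)]; auto.
  - destruct (diff_on_elim _ _ _ Hf) as (f0 & f1 & f2 & f3 & f4).
    destruct (diff_on_elim _ _ _ Ha) as (a0 & a1 & a2 & a3 & a4).
    destruct (diff_on_elim _ _ _ Hb) as (b0 & b1 & b2 & b3 & b4).
    assert (Ha' : diff_on U n a) by (apply diff_on_le with (S n); auto).
    assert (Hb' : diff_on U n b) by (apply diff_on_le with (S n); auto).
    apply diff_on_intro with
      (fx := fun x y => Dx f (a x y) (b x y) * Dx a x y + Dy f (a x y) (b x y) * Dx b x y)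
      (fy := fun x y => Dx f (a x y) (b x y) * Dy a x y + Dy f (a x y) (b x y) * Dy b x y);
      auto; try (apply diff_on_plus; auto; apply diff_on_mult; auto); intros x y Hxy.
    + apply continuity_2d_pt_comp; auto.
    + apply is_derive_Reals.
      apply (derivable_pt_lim_comp_2d f (fun t => a t y) (fun t => b t y));
        [eapply diff_on_differentiable; eauto| |]; apply is_derive_Reals; [now apply a1|now apply b1].
    + apply is_derive_Reals.
      apply (derivable_pt_lim_comp_2d f (fun t => a x t) (fun t => b x t));
        [eapply diff_on_differentiable; eauto| |]; apply is_derive_Reals; [now apply a2|now apply b2].
Qed.

(** * Nijenhuis operators with prescribed trace and discriminant *)

Lemma smooth_on_diff_on (U : R * R -> Prop) (f : R -> R -> R) :
  smooth_on U f <-> forall n, diff_on U n f.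
Proof. split; intros H; [intros n x y Hxy|intros x y Hxy n]; now apply H. Qed.

Lemma smooth_on_ext (U : R * R -> Prop) (f h : R -> R -> R) :
  open U -> (forall x y, U (x, y) -> f x y = h x y) ->
  smooth_on U f -> smooth_on U h.
Proof.
  intros HU E Hf. apply smooth_on_diff_on. intros n. apply diff_on_ext with f; auto.
  now apply smooth_on_diff_on.
Qed.

Lemma smooth_on_subset (U V : R * R -> Prop) (f : R -> R -> R) :
  (forall x y, V (x, y) -> U (x, y)) -> smooth_on U f -> smooth_on V f.
Proof. intros H Hf x y Hxy. now apply Hf, H. Qed.

Lemma smooth_on_elim (U : R * R -> Prop) (f : R -> R -> R) :
  smooth_on U f ->
  (forall x y, U (x, y) -> continuity_2d_pt f x y) /\
  (forall x y, U (x, y) -> is_derive (fun t => f t y) x (Dx f x y)) /\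
  (forall x y, U (x, y) -> is_derive (fun t => f x t) y (Dy f x y)) /\
  smooth_on U (Dx f) /\ smooth_on U (Dy f).
Proof.
  intros Hf. assert (H := proj1 (smooth_on_diff_on U f) Hf).
  destruct (diff_on_elim U 0 f (H 1%nat)) as (H0 & H1 & H2 & _).
  split; [|split; [|split; [|split]]]; auto; apply smooth_on_diff_on; intros n;
    apply (diff_on_elim U n f (H (S n))).
Qed.

(* The components of [N_L] on the coordinate fields of x and y, in this order. *)
Definition frame_torsion_1 (L : tensor11) (x y : R) : R :=
  let a := fun x y => m11 (L x y) in let b := fun x y => m12 (L x y) in
  let c := fun x y => m21 (L x y) in let d := fun x y => m22 (L x y) in
  c x y * Dy b x y - b x y * Dx a x y - d x y * Dy a x y + a x y * Dy a x y
  + b x y * Dy c x y - b x y * Dx d x y.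

Definition frame_torsion_2 (L : tensor11) (x y : R) : R :=
  let a := fun x y => m11 (L x y) in let b := fun x y => m12 (L x y) in
  let c := fun x y => m21 (L x y) in let d := fun x y => m22 (L x y) in
  a x y * Dx d x y - b x y * Dx c x y + c x y * Dy a x y - c x y * Dx b x y
  + c x y * Dy d x y - d x y * Dx d x y.

Lemma Derive_dot (a b c d : R -> R) (x : R) :
  ex_derive a x -> ex_derive b x -> ex_derive c x -> ex_derive d x ->
  Derive (fun t => a t * b t + c t * d t) x =
  Derive a x * b x + a x * Derive b x + (Derive c x * d x + c x * Derive d x).
Proof.
  intros Ha Hb Hc Hd. apply is_derive_unique, is_derive_plus_R;
    apply is_derive_mult_R; now apply Derive_correct.
Qed.

(** The torsion is a tensor, antisymmetric in its arguments: all derivatives of [v] and [u] cancel,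
    and in dimension two only the determinant of their components remains as a factor. *)
Lemma torsion_formula (U : R * R -> Prop) (L : tensor11) (v u : vfield) (x y : R) :
  smooth_tensor11 U L -> smooth_vfield U v -> smooth_vfield U u -> U (x, y) ->
  torsion L v u x y =
  ((fst (v x y) * snd (u x y) - snd (v x y) * fst (u x y)) * frame_torsion_1 L x y,
   (fst (v x y) * snd (u x y) - snd (v x y) * fst (u x y)) * frame_torsion_2 L x y).
Proof.
  intros (Ha & Hb & Hc & Hd) (Hv1 & Hv2) (Hu1 & Hu2) Hxy.
  assert (EX : forall f, smooth_on U f ->
            ex_derive (fun t => f t y) x /\ ex_derive (fun t => f x t) y).
  { intros f Hf. destruct (smooth_on_elim U f Hf) as (_ & H1 & H2 & _).
    split; eexists; [now apply H1|now apply H2]. }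
  assert (DD : forall p q r s, smooth_on U p -> smooth_on U q -> smooth_on U r -> smooth_on U s ->
    Dx (fun x y => p x y * q x y + r x y * s x y) x y =
      Dx p x y * q x y + p x y * Dx q x y + (Dx r x y * s x y + r x y * Dx s x y) /\
    Dy (fun x y => p x y * q x y + r x y * s x y) x y =
      Dy p x y * q x y + p x y * Dy q x y + (Dy r x y * s x y + r x y * Dy s x y)).
  { intros p q r s Hp Hq Hr Hs. unfold Dx, Dy. split.
    - apply (Derive_dot (fun t => p t y) (fun t => q t y) (fun t => r t y) (fun t => s t y));
        now apply EX.
    - apply (Derive_dot (fun t => p x t) (fun t => q x t) (fun t => r x t) (fun t => s x t));
        now apply EX. }
  pose proof (DD _ _ _ _ Ha Hv1 Hb Hv2) as [E1 E2].
  pose proof (DD _ _ _ _ Ha Hu1 Hb Hu2) as [E3 E4].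
  pose proof (DD _ _ _ _ Hc Hv1 Hd Hv2) as [E5 E6].
  pose proof (DD _ _ _ _ Hc Hu1 Hd Hu2) as [E7 E8].
  unfold torsion, bracket, lie_derivative, act, mapply, minus, plus, opp,
    frame_torsion_1, frame_torsion_2; simpl. unfold prod_plus, prod_opp; simpl. unfold plus, opp; simpl.
  rewrite E1, E2, E3, E4, E5, E6, E7, E8.
  f_equal; ring.
Qed.

Lemma nijenhuis_operator_iff (U : R * R -> Prop) (L : tensor11) :
  open U ->
  nijenhuis_operator U L <->
  smooth_tensor11 U L /\
  forall x y, U (x, y) -> frame_torsion_1 L x y = 0 /\ frame_torsion_2 L x y = 0.
Proof.
  intros HU. split; intros [HL H]; split; auto.
  - intros x y Hxy.
    assert (C : forall p : R * R, smooth_vfield U (fun _ _ => p)).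
    { intros p. split; apply smooth_on_diff_on; intros n; now apply diff_on_const. }
    (* The determinant of the coordinate fields is 1, so the formula returns the two frame
       components themselves. *)
    pose proof (H _ _ (C (1, 0)) (C (0, 1)) x y Hxy) as E.
    rewrite (torsion_formula U) in E; auto. simpl in E.
    injection E. intros. lra.
  - intros v u Hv Hu x y Hxy. rewrite (torsion_formula U); auto.
    destruct (H x y Hxy) as [-> ->]. f_equal; ring.
Qed.

Lemma Dx_ext_on (U : R * R -> Prop) (f h : R -> R -> R) (x y : R) :
  open U -> (forall x y, U (x, y) -> f x y = h x y) -> U (x, y) ->
  Dx f x y = Dx h x y.
Proof.
  intros HU E Hxy. apply Derive_ext_loc.
  apply (locally_2d_1d_const_y (fun x y => f x y = h x y)).
  generalize (open_locally_2d U x y HU Hxy). apply locally_2d_impl, locally_2d_forall. auto.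
Qed.

Lemma Dy_ext_on (U : R * R -> Prop) (f h : R -> R -> R) (x y : R) :
  open U -> (forall x y, U (x, y) -> f x y = h x y) -> U (x, y) ->
  Dy f x y = Dy h x y.
Proof.
  intros HU E Hxy. apply Derive_ext_loc.
  apply (locally_2d_1d_const_x (fun x y => f x y = h x y)).
  generalize (open_locally_2d U x y HU Hxy). apply locally_2d_impl, locally_2d_forall. auto.
Qed.

(* In dimension two [N_L = 0] is equivalent to [L^* d(tr L) = d(tr (L^2)) / 2]; with
   [tr L = x] the left side is the first row of [L]. *)
Lemma nijenhuis_with_discriminant_iff (U : R * R -> Prop) (g : R -> R -> R) (L : tensor11) :
  open U ->
  nijenhuis_with_discriminant U g L <->
  smooth_tensor11 U L /\
  forall x y, U (x, y) ->
    m11 (L x y) = x / 2 + Dx g x y /\ m12 (L x y) = Dy g x y /\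
    m22 (L x y) = x / 2 - Dx g x y /\
    g x y - Dx g x y ^ 2 = Dy g x y * m21 (L x y).
Proof.
  intros HU. unfold nijenhuis_with_discriminant. rewrite (nijenhuis_operator_iff U L HU).
  (* With only the trace and discriminant prescribed, the torsion components are exactly the defects
     in m12 = g_y and m22 = x/2 - g_x. Hence [K] serves both implications. *)
  assert (K : smooth_tensor11 U L ->
    (forall x y, U (x, y) -> mtrace (L x y) = x /\ (mtrace (L x y) / 2) ^ 2 - mdet (L x y) = g x y) ->
    forall x y, U (x, y) ->
     frame_torsion_1 L x y = Dy g x y - m12 (L x y) /\
     frame_torsion_2 L x y = x / 2 - Dx g x y - m22 (L x y)).
  { intros (Ha & Hb & Hc & Hd) HT x y Hxy.
    destruct (smooth_on_elim _ _ Ha) as (_ & a1 & a2 & _).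
    destruct (smooth_on_elim _ _ Hb) as (_ & b1 & b2 & _).
    destruct (smooth_on_elim _ _ Hc) as (_ & c1 & c2 & _).
    destruct (smooth_on_elim _ _ Hd) as (_ & d1 & d2 & _).
    assert (ED : forall x y, U (x, y) -> m22 (L x y) = x - m11 (L x y)).
    { intros x0 y0 H0. destruct (HT x0 y0 H0) as [E _]. unfold mtrace in E. lra. }
    assert (EG : forall x y, U (x, y) ->
       g x y = x * x / 4 - (m11 (L x y) * m22 (L x y) - m12 (L x y) * m21 (L x y))).
    { intros x0 y0 H0. destruct (HT x0 y0 H0) as [E1 E2].
      rewrite <- E2, E1. unfold mdet. field. }
    set (a := fun x y => m11 (L x y)) in *. set (b := fun x y => m12 (L x y)) in *.
    set (c := fun x y => m21 (L x y)) in *. set (d := fun x y => m22 (L x y)) in *.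
    assert (Edx : Dx d x y = 1 - Dx a x y).
    { rewrite (Dx_ext_on U d (fun x y => x - a x y)); auto.
      apply is_derive_unique. apply @is_derive_minus; [apply @is_derive_id|now apply a1]. }
    assert (Edy : Dy d x y = - Dy a x y).
    { rewrite (Dy_ext_on U d (fun x y => x - a x y)); auto.
      apply is_derive_unique. replace (- Dy a x y) with (0 - Dy a x y) by ring.
      apply @is_derive_minus; [apply @is_derive_const|now apply a2]. }
    assert (Egx : Dx g x y = x / 2 - (Dx a x y * d x y + a x y * Dx d x y
                                 - (Dx b x y * c x y + b x y * Dx c x y))).
    { rewrite (Dx_ext_on U g _ x y HU EG Hxy).
      apply is_derive_unique. apply @is_derive_minus; [auto_derive; auto; field|].
      apply @is_derive_minus.
      - apply (is_derive_mult_R (fun t => a t y) (fun t => d t y)); [now apply a1|now apply d1].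
      - apply (is_derive_mult_R (fun t => b t y) (fun t => c t y)); [now apply b1|now apply c1]. }
    assert (Egy : Dy g x y = 0 - (Dy a x y * d x y + a x y * Dy d x y
                                 - (Dy b x y * c x y + b x y * Dy c x y))).
    { rewrite (Dy_ext_on U g _ x y HU EG Hxy).
      apply is_derive_unique. apply @is_derive_minus; [apply @is_derive_const|].
      apply @is_derive_minus.
      - apply (is_derive_mult_R (fun t => a x t) (fun t => d x t)); [now apply a2|now apply d2].
      - apply (is_derive_mult_R (fun t => b x t) (fun t => c x t)); [now apply b2|now apply c2]. }
    unfold frame_torsion_1, frame_torsion_2. fold a b c d.
    change (m11 (L x y)) with (a x y). change (m21 (L x y)) with (c x y).
    change (m12 (L x y)) with (b x y). change (m22 (L x y)) with (d x y).
    rewrite Egx, Egy, Edx, Edy. split; [ring|].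
    assert (E : d x y = x - a x y) by now apply ED. rewrite E. field. }
  split.
  - intros [[HL HN] HT]. split; auto. intros x y Hxy.
    destruct (K HL HT x y Hxy) as [K1 K2]. destruct (HN x y Hxy) as [N1 N2].
    destruct (HT x y Hxy) as [T1 T2].
    assert (B : m12 (L x y) = Dy g x y) by lra.
    assert (D : m22 (L x y) = x / 2 - Dx g x y) by lra.
    assert (A : m11 (L x y) = x / 2 + Dx g x y) by (unfold mtrace in T1; lra).
    (* With these entries x^2/4 - det L equals g_x^2 + g_y m21, which is the remaining equation. *)
    repeat split; auto. rewrite <- T2, T1. unfold mdet. rewrite A, B, D. field.
  - intros [HL H].
    assert (HT : forall x y, U (x, y) ->
      mtrace (L x y) = x /\ (mtrace (L x y) / 2) ^ 2 - mdet (L x y) = g x y).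
    { intros x y Hxy. destruct (H x y Hxy) as (A & B & D & C).
      assert (T : mtrace (L x y) = x) by (unfold mtrace; rewrite A, D; field).
      split; auto. rewrite T. unfold mdet. rewrite A, B, D, <- C. field. }
    repeat split; auto; try apply HL; try (apply HT; auto); auto;
    destruct (K HL HT x y H0) as [K1 K2], (H x y H0) as (A & B & D & C); lra.
Qed.

(** * Operators in normal coordinates *)

(** The Jacobian is [[1, 0], [p, q]] with determinant q, so the conjugation can be written out with
    q as the only denominator. *)
Lemma matrix_in_coords_fst (yt : R -> R -> R) (L : tensor11) (x y : R) :
  Dy yt x y <> 0 ->
  let a := m11 (L x y) in let b := m12 (L x y) in
  let c := m21 (L x y) in let d := m22 (L x y) in
  let p := Dx yt x y in let q := Dy yt x y in
  matrix_in_coords (fun a _ => a) yt L x y =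
  Mat2 (a - p * b / q) (b / q) (p * a + q * c - p * (p * b / q + d)) (p * b / q + d).
Proof.
  intros Hq a b c d p q. unfold matrix_in_coords, jacobian, mmul, minv, mdet; simpl.
  replace (Dx (fun a _ => a) x y) with 1 by (symmetry; exact (Derive_id x)).
  replace (Dy (fun a _ => a) x y) with 0 by (symmetry; exact (Derive_const x y)).
  fold a b c d p q. f_equal; field; exact Hq.
Qed.

Lemma normal_form_derivatives (U : R * R -> Prop) (g yt : R -> R -> R) (s k : R) :
  open U -> smooth_on U yt ->
  (forall x y, U (x, y) -> g x y = s * yt x y ^ 2 + k * x ^ 2 / 4) ->
  smooth_on U g /\
  forall x y, U (x, y) ->
    Dx g x y = 2 * s * yt x y * Dx yt x y + k * x / 2 /\
    Dy g x y = 2 * s * yt x y * Dy yt x y.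
Proof.
  intros HU Hyt Eg. destruct (smooth_on_elim _ _ Hyt) as (_ & t1 & t2 & _). split.
  - apply smooth_on_ext with (fun x y => s * (yt x y * yt x y) + k / 4 * (x * x)); auto.
    + intros x y Hxy. rewrite Eg; auto. field.
    + apply smooth_on_diff_on. intros n. assert (H := proj1 (smooth_on_diff_on U yt) Hyt n).
      repeat (apply diff_on_plus || apply diff_on_mult || apply diff_on_const || apply diff_on_fst); auto.
  - intros x y Hxy. rewrite (Dx_ext_on U g _ x y HU Eg Hxy), (Dy_ext_on U g _ x y HU Eg Hxy).
    unfold Dx at 1, Dy at 1. split; apply is_derive_unique.
    + apply is_derive_ext with (fun t => s * (yt t y * yt t y) + k / 4 * (t * t)).
      { intros t. simpl. field. }
      replace (2 * s * yt x y * Dx yt x y + k * x / 2) with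
        ((0 * (yt x y * yt x y) + s * (Dx yt x y * yt x y + yt x y * Dx yt x y))
          + (0 * (x * x) + k / 4 * (1 * x + x * 1))) by field.
      apply is_derive_plus_R.
      * apply (is_derive_mult_R (fun _ => s) (fun t => yt t y * yt t y)); [apply @is_derive_const|].
        apply (is_derive_mult_R (fun t => yt t y) (fun t => yt t y)); now apply t1.
      * apply (is_derive_mult_R (fun _ => k / 4) (fun t => t * t)); [apply @is_derive_const|].
        apply (is_derive_mult_R (fun t => t) (fun t => t)); apply @is_derive_id.
    + apply is_derive_ext with (fun t => s * (yt x t * yt x t) + k * x ^ 2 / 4).
      { intros t. simpl. field. }
      replace (2 * s * yt x y * Dy yt x y) with
        ((0 * (yt x y * yt x y) + s * (Dy yt x y * yt x y + yt x y * Dy yt x y)) + 0) by ring.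
      apply is_derive_plus_R; [|apply @is_derive_const].
      apply (is_derive_mult_R (fun _ => s) (fun t => yt x t * yt x t)); [apply @is_derive_const|].
      apply (is_derive_mult_R (fun t => yt x t) (fun t => yt x t)); now apply t2.
Qed.

(* The zero set of [t] is nowhere dense on vertical lines, so a continuous [E] with
   [E t = 0] vanishes. *)
Lemma cancel_coordinate (U : R * R -> Prop) (t E : R -> R -> R) (x y : R) :
  open U -> (forall x y, U (x, y) -> Dy t x y <> 0) ->
  (forall x y, U (x, y) -> E x y * t x y = 0) ->
  U (x, y) -> continuity_2d_pt E x y -> E x y = 0.
Proof.
  intros HU Ht HE Hxy Hc. destruct (Req_dec (E x y) 0) as [|Hnz]; auto.
  exfalso. apply (Ht x y Hxy).
  transitivity (Derive (fun _ => 0) y); [|apply Derive_const].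
  apply Derive_ext_loc, (locally_2d_1d_const_x (fun x y => t x y = 0)).
  generalize (locally_2d_and _ _ _ _ (open_locally_2d U x y HU Hxy)
                (continuity_2d_pt_neq_0 E x y Hc Hnz)).
  apply locally_2d_impl, locally_2d_forall. intros u v [H1 H2].
  destruct (Rmult_integral _ _ (HE u v H1)); tauto.
Qed.

(* [k = 1] and [k = 0] give the two normal forms. *)
Lemma operator_in_normal_coordinates
  (U : R * R -> Prop) (g yt : R -> R -> R) (s k : R) (L : tensor11) :
  open U -> second_coordinate_change U yt -> s * s = 1 -> k * k = k ->
  (forall x y, U (x, y) -> g x y = s * yt x y ^ 2 + k * x ^ 2 / 4) ->
  nijenhuis_with_discriminant U g L <->
  (forall x y, U (x, y) -> matrix_in_coords (fun a _ => a) yt L x y =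
     Mat2 (x / 2 + k * x / 2) (s * (2 * yt x y)) (yt x y / 2) (x / 2 - k * x / 2)).
Proof.
  intros HU [Hyt Hq] Hs Hk Eg.
  destruct (normal_form_derivatives U g yt s k HU Hyt Eg) as [Hg Dg].
  destruct (smooth_on_elim _ _ Hyt) as (_ & _ & _ & Sp & Sq).
  rewrite (nijenhuis_with_discriminant_iff U g L HU).
  (* [N] is the quotient of g - g_x^2 by 2 s yt. Since g_y = 2 s yt yt_y, cancelling 2 s yt in g -
     g_x^2 = g_y c leaves yt_y c = N, which has a smooth solution c. *)
  set (N := fun x y => yt x y / 2 - Dx yt x y * (k * x + 2 * s * yt x y * Dx yt x y)).
  assert (SN : smooth_on U N).
  { apply smooth_on_diff_on. intros n. apply (proj1 (smooth_on_diff_on _ _)) with (n := n) in Hyt, Sp, Sq.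
    unfold N, Rdiv.
    repeat (apply diff_on_minus || apply diff_on_plus || apply diff_on_mult || apply diff_on_const || apply diff_on_fst); auto. }
  transitivity (smooth_tensor11 U L /\ forall x y, U (x, y) ->
    m11 (L x y) = x / 2 + Dx g x y /\ m12 (L x y) = Dy g x y /\
    m22 (L x y) = x / 2 - Dx g x y /\ Dy yt x y * m21 (L x y) = N x y).
  - assert (EN : forall x y, U (x, y) ->
      g x y - Dx g x y ^ 2 = 2 * s * yt x y * N x y).
    { intros x y Hxy. destruct (Dg x y Hxy) as [-> _]. rewrite Eg; auto.
      (* The only term without a factor yt is (k - k^2) x^2/4; it vanishes because k^2 = k. *)
      transitivity (2 * s * yt x y * N x y + (k - k * k) * x ^ 2 / 4);
        [unfold N; field|rewrite Hk; field]. }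
    split; intros [HL H]; (split; [exact HL|]).
    + assert (HE : forall x y, U (x, y) ->
        (Dy yt x y * m21 (L x y) - N x y) * yt x y = 0).
      { intros x y Hxy. destruct (H x y Hxy) as (_ & _ & _ & C).
        rewrite EN in C; auto. destruct (Dg x y Hxy) as [_ E]. rewrite E in C.
        transitivity ((s * s) * ((Dy yt x y * m21 (L x y) - N x y) * yt x y)); [rewrite Hs; ring|].
        transitivity (s / 2 * (2 * s * yt x y * Dy yt x y * m21 (L x y) - 2 * s * yt x y * N x y));
          [field|rewrite C; ring]. }
      intros x y Hxy. destruct (H x y Hxy) as (A & B & C & _). repeat split; auto.
      apply Rminus_diag_uniq.
      apply (cancel_coordinate U yt (fun x y => Dy yt x y * m21 (L x y) - N x y)); auto.
      apply (diff_on_cont U 0); auto. destruct HL as (_ & _ & Hc & _).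
      apply (proj1 (smooth_on_diff_on _ _)) with (n := 0%nat) in Sq, Hc, SN.
      apply diff_on_minus; auto. now apply diff_on_mult.
    + intros x y Hxy. destruct (H x y Hxy) as (A & B & C & D). repeat split; auto.
      rewrite EN, <- D; auto. destruct (Dg x y Hxy) as [_ ->]. ring.
  - assert (K : forall x y, U (x, y) -> 
      (m11 (L x y) = x / 2 + Dx g x y /\ m12 (L x y) = Dy g x y /\
       m22 (L x y) = x / 2 - Dx g x y /\ Dy yt x y * m21 (L x y) = N x y) <->
      matrix_in_coords (fun a _ => a) yt L x y =
      Mat2 (x / 2 + k * x / 2) (s * (2 * yt x y)) (yt x y / 2) (x / 2 - k * x / 2)).
    { intros x y Hxy. assert (Hq' := Hq x y Hxy). rewrite matrix_in_coords_fst; auto.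
      destruct (Dg x y Hxy) as [-> ->]. unfold N. split.
      - intros (-> & -> & -> & ->). f_equal; field; auto.
      - intros E. injection E. intros E4 E3 E2 E1.
        assert (B : m12 (L x y) = 2 * s * yt x y * Dy yt x y).
        { replace (m12 (L x y)) with (m12 (L x y) / Dy yt x y * Dy yt x y) by (field; auto).
          rewrite E2. ring. }
        assert (PB : Dx yt x y * m12 (L x y) / Dy yt x y = 2 * s * yt x y * Dx yt x y)
          by (rewrite B; field; auto).
        rewrite E4 in E3. rewrite PB in E1, E4.
        assert (A : m11 (L x y) = x / 2 + (2 * s * yt x y * Dx yt x y + k * x / 2)) by lra.
        repeat split; auto; try lra. rewrite A in E3. lra. }
    split.
    + intros [_ H] x y Hxy. apply K; auto.
    (* Smoothness of [L] is not given in this direction. It is recovered because each entry agrees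
       on [U] with a smooth formula, the lower left one with N / yt_y. *)
    + intros H. assert (H' := fun x y Hxy => proj2 (K x y Hxy) (H x y Hxy)). split; auto.
      destruct (smooth_on_elim _ _ Hg) as (_ & _ & _ & Sgx & Sgy).
      repeat split.
      * apply smooth_on_ext with (fun x y => x / 2 + Dx g x y); auto.
        { intros x y Hxy. symmetry. apply H'; auto. }
        apply smooth_on_diff_on; intros n. apply (proj1 (smooth_on_diff_on _ _)) with (n := n) in Sgx.
        apply diff_on_plus; auto. apply diff_on_mult; [|apply diff_on_fst|apply diff_on_const]; auto.
      * apply smooth_on_ext with (Dy g); auto. intros x y Hxy. symmetry. apply H'; auto.
      * apply smooth_on_ext with (fun x y => N x y / Dy yt x y); auto.
        { intros x y Hxy. destruct (H' x y Hxy) as (_ & _ & _ & <-). field; auto. }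
        apply smooth_on_diff_on; intros n. apply (proj1 (smooth_on_diff_on _ _)) with (n := n) in SN, Sq.
        apply diff_on_div; auto.
      * apply smooth_on_ext with (fun x y => x / 2 - Dx g x y); auto.
        { intros x y Hxy. symmetry. apply H'; auto. }
        apply smooth_on_diff_on; intros n. apply (proj1 (smooth_on_diff_on _ _)) with (n := n) in Sgx.
        apply diff_on_minus; auto. apply diff_on_mult; [|apply diff_on_fst|apply diff_on_const]; auto.
Qed.

(** * Hadamard's division *)

(** Unlike a general neighbourhood, a rectangle contains with each point the vertical segment to the
    x-axis, along which the integrals below are taken. The half-widths are separate because the
    critical point exists only over a range of x that may be narrower than the range of y. *)
Definition rect (a b : R) (p : R * R) : Prop := Rabs (fst p) < a /\ Rabs (snd p) < b.

Lemma Rabs_lt_near (u x d : R) : Rabs (u - x) < d - Rabs x -> Rabs u < d.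
Proof. generalize (Rabs_triang (u - x) x). replace (u - x + x) with u by ring. lra. Qed.

Lemma open_rect (a b : R) : open (rect a b).
Proof.
  intros [x y] [Hx Hy]; simpl in *.
  apply filter_imp with (fun z => rect a b (fst z, snd z)); [now intros [u v]|].
  apply (proj1 (locally_2d_locally (fun u v => rect a b (u, v)) x y)).
  assert (Hd : 0 < Rmin (a - Rabs x) (b - Rabs y)) by (apply Rmin_pos; lra).
  exists (mkposreal _ Hd). simpl. intros u v Hu Hv.
  assert (M1 := Rmin_l (a - Rabs x) (b - Rabs y)). assert (M2 := Rmin_r (a - Rabs x) (b - Rabs y)).
  split; simpl.
  - apply Rabs_lt_near with x. lra.
  - apply Rabs_lt_near with y. lra.
Qed.

Lemma open_contains_rect (U : R * R -> Prop) :
  nbhd_origin U -> exists r, 0 < r /\ forall x y, rect r r (x, y) -> U (x, y).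
Proof.
  intros [HU H0]. destruct (open_locally_2d U 0 0 HU H0) as [d Hd].
  exists d. split; [apply cond_pos|]. intros x y [Hx Hy]; simpl in *.
  apply Hd; now rewrite Rminus_0_r.
Qed.

Lemma Rabs_scale_lt (t y b : R) : 0 <= t <= 1 -> Rabs y < b -> Rabs (t * y) < b.
Proof.
  intros Ht Hy. rewrite Rabs_mult, (Rabs_pos_eq t) by lra.
  apply Rle_lt_trans with (1 * Rabs y); [|lra].
  apply Rmult_le_compat_r; [apply Rabs_pos|lra].
Qed.

(** For k = 0 and F = f_y this is Hadamard's quotient (f(x, y) - f(x, 0)) / y, extended across y =
    0. Each derivative in y brings out a factor t; the weights t^k make the family closed under
    differentiation. *)
Definition moment (k : nat) (F : R -> R -> R) (x y : R) : R :=
  RInt (fun t => t ^ k * F x (t * y)) 0 1.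

Lemma continuity_2d_pt_section (F : R -> R -> R) (x y : R) :
  continuity_2d_pt F x y -> continuous (F x) y.
Proof.
  intros H. apply continuity_pt_filterlim. intros eps Heps.
  destruct (locally_2d_1d_const_x _ x y (H (mkposreal eps Heps))) as [d Hd].
  exists d. split; [apply cond_pos|]. intros z [_ Hz]. now apply Hd.
Qed.

Lemma continuity_2d_pt_pow2 (k : nat) (x y : R) : continuity_2d_pt (fun _ v => v ^ k) x y.
Proof.
  apply (continuity_1d_2d_pt_comp (fun v => v ^ k)); [|apply continuity_2d_pt_id2].
  apply derivable_continuous_pt, derivable_pt_pow.
Qed.

Section Moment.

Variables a b : R.

Lemma rect_scale (x y t : R) : 0 <= t <= 1 -> rect a b (x, y) -> rect a b (x, t * y).
Proof. intros Ht [Hx Hy]. split; auto. now apply Rabs_scale_lt. Qed.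

Lemma moment_integrable (k : nat) (F : R -> R -> R) (x y : R) :
  (forall x y, rect a b (x, y) -> continuity_2d_pt F x y) ->
  rect a b (x, y) -> ex_RInt (fun t => t ^ k * F x (t * y)) 0 1.
Proof.
  intros HF [Hx Hy]. apply (@ex_RInt_continuous R_CompleteNormedModule).
  rewrite Rmin_left, Rmax_right by lra. intros t Ht.
  apply (@continuous_mult R_UniformSpace R_AbsRing).
  - apply (@ex_derive_continuous R_AbsRing R_NormedModule). auto_derive. auto.
  - apply (continuous_comp (fun t => t * y) (F x)).
    + apply (@ex_derive_continuous R_AbsRing R_NormedModule). auto_derive. auto.
    + apply continuity_2d_pt_section, HF. split; simpl in *; auto. now apply Rabs_scale_lt.
Qed.

Lemma moment_continuous (k : nat) (F : R -> R -> R) (x y : R) :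
  (forall x y, rect a b (x, y) -> continuity_2d_pt F x y) ->
  rect a b (x, y) -> continuity_2d_pt (moment k F) x y.
Proof.
  intros HF Hxy. pose proof Hxy as [Hx Hy]; simpl in Hx, Hy.
  (* Midpoints between the point and the boundary: the closed rectangle with these half-widths is a
     neighbourhood of (x, y) inside the open one, and [F] is uniformly continuous on it. *)
  set (x1 := (a + Rabs x) / 2). set (y1 := (b + Rabs y) / 2).
  assert (Hc : forall u v, - x1 <= u <= x1 -> - y1 <= v <= y1 -> continuity_2d_pt F u v).
  { intros u v Hu Hv. apply HF. split; simpl.
    - apply Rle_lt_trans with x1; [apply Rabs_le; lra|unfold x1; lra].
    - apply Rle_lt_trans with y1; [apply Rabs_le; lra|unfold y1; lra]. }
  intros eps.
  destruct (uniform_continuity_2d F _ _ _ _ Hc (pos_div_2 eps)) as [d Hd].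
  assert (H2 : 0 < Rmin d (Rmin (x1 - Rabs x) (y1 - Rabs y))).
  { repeat apply Rmin_pos; [apply cond_pos|unfold x1|unfold y1]; lra. }
  exists (mkposreal _ H2). simpl. intros u v Hu Hv.
  assert (M1 := Rmin_l d (Rmin (x1 - Rabs x) (y1 - Rabs y))).
  assert (M2 := Rmin_r d (Rmin (x1 - Rabs x) (y1 - Rabs y))).
  assert (M3 := Rmin_l (x1 - Rabs x) (y1 - Rabs y)).
  assert (M4 := Rmin_r (x1 - Rabs x) (y1 - Rabs y)).
  assert (Bu : Rabs u < x1).
  { replace u with ((u - x) + x) by ring. eapply Rle_lt_trans; [apply Rabs_triang|lra]. }
  assert (Bv : Rabs v < y1).
  { replace v with ((v - y) + y) by ring. eapply Rle_lt_trans; [apply Rabs_triang|lra]. }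
  assert (Huv : rect a b (u, v)).
  { split; simpl; [apply Rlt_trans with x1; auto; unfold x1; lra|apply Rlt_trans with y1; auto; unfold y1; lra]. }
  assert (I1 := moment_integrable k F u v HF Huv).
  assert (I2 := moment_integrable k F x y HF Hxy).
  unfold moment.
  change (Rabs (minus (RInt (fun t => t ^ k * F u (t * v)) 0 1) (RInt (fun t => t ^ k * F x (t * y)) 0 1)) < eps).
  rewrite <- RInt_minus; auto.
  apply Rle_lt_trans with ((1 - 0) * (eps / 2)); [|generalize (cond_pos eps); lra].
  apply abs_RInt_le_const; [lra|now apply @ex_RInt_minus|].
  intros t Ht. unfold minus, plus, opp; simpl.
  replace (t ^ k * F u (t * v) + - (t ^ k * F x (t * y))) with (t ^ k * (F u (t * v) - F x (t * y))) by ring.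
  rewrite Rabs_mult, <- RPow_abs, (Rabs_pos_eq t) by lra.
  assert (P0 : 0 <= t ^ k) by (apply pow_le; lra).
  assert (P1 : t ^ k <= 1) by (rewrite <- (pow1 k); apply pow_incr; lra).
  apply Rle_trans with (1 * Rabs (F u (t * v) - F x (t * y))).
  { apply Rmult_le_compat_r; [apply Rabs_pos|auto]. }
  rewrite Rmult_1_l. left. apply Hd.
  - apply Rabs_le_between. unfold x1; lra.
  - apply Rabs_le_between. left. apply Rabs_scale_lt; auto. unfold y1; lra.
  - apply Rabs_le_between. lra.
  - apply Rabs_le_between. left. apply Rabs_scale_lt; auto.
  - lra.
  - rewrite <- Rmult_minus_distr_l. apply Rabs_scale_lt; auto. lra.
Qed.

Lemma is_derive_moment_x (k : nat) (F : R -> R -> R) (x y : R) :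
  diff_on (rect a b) 1 F -> rect a b (x, y) ->
  is_derive (fun t => moment k F t y) x (moment k (Dx F) x y).
Proof.
  intros HF Hxy. assert (HO := open_rect a b).
  destruct (diff_on_elim _ _ _ HF) as (F0 & F1 & F2 & F3 & F4).
  assert (C1 := diff_on_cont _ _ _ F3). unfold moment.
  assert (Hloc : locally x (fun u => rect a b (u, y)))
    by apply (locally_2d_1d_const_y _ _ _ (open_locally_2d _ x y HO Hxy)).
  assert (HD : forall u t, rect a b (u, t * y) ->
    is_derive (fun z => t ^ k * F z (t * y)) u (t ^ k * Dx F u (t * y))).
  { intros u t Ht. apply (is_derive_scal (fun z => F z (t * y))). now apply F1. }
  rewrite (RInt_ext _ (fun t => Derive (fun z => t ^ k * F z (t * y)) x)).
  2:{ rewrite Rmin_left, Rmax_right by lra. intros t Ht. symmetry.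
      apply is_derive_unique, HD, rect_scale; auto; lra. }
  apply (is_derive_RInt_param (fun u t => t ^ k * F u (t * y))).
  * rewrite Rmin_left, Rmax_right by lra. revert Hloc. apply filter_imp.
    intros u Hu t Ht. eexists. now apply HD, rect_scale.
  * rewrite Rmin_left, Rmax_right by lra. intros t Ht.
    assert (Ht' := rect_scale x y t Ht Hxy).
    assert (Cv : continuity_2d_pt (fun _ v => v * y) x t)
      by (apply continuity_2d_pt_mult; [apply continuity_2d_pt_id2|apply continuity_2d_pt_const]).
    apply continuity_2d_pt_ext_loc with (fun u v => v ^ k * Dx F u (v * y)).
    -- generalize (locally_2d_comp _ (fun u _ => u) (fun _ v => v * y) x t
         (open_locally_2d _ _ _ HO Ht') (continuity_2d_pt_id1 _ _) Cv).
       apply locally_2d_impl, locally_2d_forall. intros u v Huv.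
       symmetry. now apply is_derive_unique, HD.
    -- apply continuity_2d_pt_mult; [apply continuity_2d_pt_pow2|].
       apply continuity_2d_pt_comp; auto. apply continuity_2d_pt_id1.
  * revert Hloc. apply filter_imp. intros u Hu. now apply moment_integrable.
Qed.

Lemma is_derive_moment_y (k : nat) (F : R -> R -> R) (x y : R) :
  diff_on (rect a b) 1 F -> rect a b (x, y) ->
  is_derive (fun t => moment k F x t) y (moment (S k) (Dy F) x y).
Proof.
  intros HF Hxy. assert (HO := open_rect a b).
  destruct (diff_on_elim _ _ _ HF) as (F0 & F1 & F2 & F3 & F4).
  assert (C2 := diff_on_cont _ _ _ F4). unfold moment.
  assert (Hloc : locally y (fun v => rect a b (x, v)))
    by apply (locally_2d_1d_const_x _ _ _ (open_locally_2d _ x y HO Hxy)).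
  assert (HD : forall v t, rect a b (x, t * v) ->
    is_derive (fun z => t ^ k * F x (t * z)) v (t ^ S k * Dy F x (t * v))).
  { intros v t Ht. replace (t ^ S k * Dy F x (t * v)) with (t ^ k * (t * Dy F x (t * v)))
      by (simpl; ring).
    apply (is_derive_scal (fun z => F x (t * z))).
    apply (is_derive_comp (fun z => F x z) (fun z => t * z)); [now apply F2|].
    auto_derive; auto. ring. }
  rewrite (RInt_ext _ (fun t => Derive (fun z => t ^ k * F x (t * z)) y)).
  2:{ rewrite Rmin_left, Rmax_right by lra. intros t Ht. symmetry.
      apply is_derive_unique, HD, rect_scale; auto; lra. }
  apply (is_derive_RInt_param (fun v t => t ^ k * F x (t * v))).
  * rewrite Rmin_left, Rmax_right by lra. revert Hloc. apply filter_imp.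
    intros v Hv t Ht. eexists. now apply HD, rect_scale.
  * rewrite Rmin_left, Rmax_right by lra. intros t Ht.
    assert (Ht' := rect_scale x y t Ht Hxy).
    assert (Cv : continuity_2d_pt (fun u v => v * u) y t)
      by (apply continuity_2d_pt_mult; [apply continuity_2d_pt_id2|apply continuity_2d_pt_id1]).
    apply continuity_2d_pt_ext_loc with (fun u v => v ^ S k * Dy F x (v * u)).
    -- generalize (locally_2d_comp _ (fun _ _ => x) (fun u v => v * u) y t
         (open_locally_2d _ _ _ HO Ht') (continuity_2d_pt_const _ _ _) Cv).
       apply locally_2d_impl, locally_2d_forall. intros u v Huv.
       symmetry. now apply is_derive_unique, HD.
    -- apply continuity_2d_pt_mult; [apply continuity_2d_pt_pow2|].
       apply (continuity_2d_pt_comp (Dy F) (fun _ _ => x) (fun u v => v * u)); auto.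
       apply continuity_2d_pt_const.
  * revert Hloc. apply filter_imp. intros v Hv. now apply moment_integrable.
Qed.

Lemma diff_on_moment (n k : nat) (F : R -> R -> R) :
  diff_on (rect a b) n F -> diff_on (rect a b) n (moment k F).
Proof.
  assert (HO := open_rect a b).
  revert k F. induction n; intros k F HF.
  - intros x y Hxy. split; auto. apply moment_continuous; auto. now apply diff_on_cont with 0%nat.
  - destruct (diff_on_elim _ _ _ HF) as (F0 & F1 & F2 & F3 & F4).
    apply diff_on_intro with (fx := moment k (Dx F)) (fy := moment (S k) (Dy F)); auto.
    + intros. apply moment_continuous; auto.
    + intros. apply is_derive_moment_x; auto. apply diff_on_le with (S n); auto. lia.
    + intros. apply is_derive_moment_y; auto. apply diff_on_le with (S n); auto. lia.
Qed.

(** The fundamental theorem of calculus for t -> F(x, t y) on [0, 1]. *)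
Lemma hadamard (F : R -> R -> R) (x y : R) :
  diff_on (rect a b) 1 F -> rect a b (x, y) ->
  F x y = F x 0 + y * moment 0 (Dy F) x y.
Proof.
  intros HF Hxy. destruct (diff_on_elim _ _ _ HF) as (F0 & F1 & F2 & F3 & F4).
  assert (C2 := diff_on_cont _ _ _ F4).
  assert (I : is_RInt (fun t => y * Dy F x (t * y)) 0 1 (minus (F x (1 * y)) (F x (0 * y)))).
  { apply (is_RInt_derive (fun t => F x (t * y))); rewrite Rmin_left, Rmax_right by lra; intros t Ht;
      assert (Hty : rect a b (x, t * y)) by (now apply rect_scale).
    - apply (is_derive_comp (fun z => F x z) (fun t => t * y)); [now apply F2|].
      auto_derive; auto. ring.
    - apply (@continuous_mult R_UniformSpace R_AbsRing); [apply continuous_const|].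
      apply (continuous_comp (fun t => t * y) (Dy F x)).
      + apply (@ex_derive_continuous R_AbsRing R_NormedModule). auto_derive. auto.
      + now apply continuity_2d_pt_section, C2. }
  apply (@is_RInt_unique R_CompleteNormedModule) in I. unfold moment.
  rewrite (RInt_ext _ (fun t => Dy F x (t * y))) by (intros; simpl; ring).
  rewrite <- (RInt_scal (V := R_CompleteNormedModule)) with (l := y).
  - change (fun x0 => scal y (Dy F x (x0 * y))) with (fun t => y * Dy F x (t * y)).
    rewrite I. rewrite Rmult_1_l, Rmult_0_l. unfold minus, plus, opp; simpl. ring.
  - generalize (moment_integrable 0 (Dy F) x y C2 Hxy). apply ex_RInt_ext. intros; simpl; ring.
Qed.

(** At y = 0 the integrand is t^k F(x, 0), and t^k has integral 1/(k + 1). This evaluates the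
    Hadamard quotients at the critical point. *)
Lemma moment_axis (k : nat) (F : R -> R -> R) (x : R) :
  moment k F x 0 = F x 0 / INR (S k).
Proof.
  assert (E : forall t, t ^ k * F x (t * 0) = F x 0 / INR (S k) * (INR (S k) * t ^ k)).
  { intros t. rewrite Rmult_0_r. field. apply not_0_INR. lia. }
  unfold moment. rewrite (RInt_ext _ _ _ _ (fun t _ => E t)).
  assert (I : is_RInt (fun t => INR (S k) * t ^ k) 0 1 (minus (1 ^ S k) (0 ^ S k))).
  { apply (is_RInt_derive (fun t => t ^ S k)).
    - intros t _. auto_derive; auto. simpl. ring.
    - intros t _. apply (@ex_derive_continuous R_AbsRing R_NormedModule). auto_derive. auto. }
  apply (is_RInt_scal _ _ _ (F x 0 / INR (S k))) in I.
  transitivity (F x 0 / INR (S k) * (1 ^ S k - 0 ^ S k)); [exact (is_RInt_unique _ _ _ _ I)|].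
  rewrite pow1. simpl (0 ^ S k). rewrite Rmult_0_l. field. apply not_0_INR. lia.
Qed.

End Moment.

(** * Implicit functions *)

Lemma continuity_2d_pt_pos (f : R -> R -> R) (x y : R) :
  continuity_2d_pt f x y -> 0 < f x y -> locally_2d (fun u v => 0 < f u v) x y.
Proof.
  intros Hc Hp. generalize (Hc (mkposreal _ Hp)). apply locally_2d_impl, locally_2d_forall.
  intros u v H. simpl in H. apply Rabs_lt_between in H. lra.
Qed.

Lemma continuity_2d_pt_neg (f : R -> R -> R) (x y : R) :
  continuity_2d_pt f x y -> f x y < 0 -> locally_2d (fun u v => f u v < 0) x y.
Proof.
  intros Hc Hn. assert (Hp : 0 < - f x y) by lra.
  generalize (continuity_2d_pt_pos _ x y (continuity_2d_pt_opp f x y Hc) Hp).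
  apply locally_2d_impl, locally_2d_forall. intros; lra.
Qed.

Section ImplicitFunction.

Variables (p : R -> R -> R) (r : R).
Hypothesis r_pos : 0 < r.
Hypothesis p_smooth : smooth_on (rect r r) p.
Hypothesis p0 : p 0 0 = 0.
Hypothesis py_pos : forall x y, rect r r (x, y) -> 0 < Dy p x y.

Lemma implicit_increasing (x a b : R) :
  Rabs x < r -> Rabs a < r -> Rabs b < r -> a < b -> p x a < p x b.
Proof.
  intros Hx Ha Hb Hab. destruct (smooth_on_elim _ _ p_smooth) as (_ & _ & p2 & _).
  assert (HR : forall t, a <= t <= b -> rect r r (x, t)).
  { intros t Ht. split; auto; simpl. apply Rabs_lt_between in Ha, Hb. apply Rabs_lt_between. lra. }
  destruct (MVT_gen (p x) a b (Dy p x)) as [c [Hc Ec]].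
  - rewrite Rmin_left, Rmax_right by lra. intros t Ht. apply p2, HR. lra.
  - rewrite Rmin_left, Rmax_right by lra. intros t Ht.
    apply continuity_pt_filterlim.
    apply (@ex_derive_continuous R_AbsRing R_NormedModule). eexists. apply p2, HR, Ht.
  - rewrite Rmin_left, Rmax_right in Hc by lra.
    assert (0 < Dy p x c * (b - a)) by (apply Rmult_lt_0_compat; [apply py_pos, HR, Hc|lra]).
    lra.
Qed.

(** By monotonicity p(0, -r/2) < 0 < p(0, r/2). Both signs persist for small x, and the intermediate
    value theorem gives a zero between. Stopping at r/2 leaves room to move the zero vertically
    inside the domain. *)
Lemma implicit_exists :
  exists d, 0 < d <= r / 2 /\
  forall x, Rabs x < d -> exists y, Rabs y < r / 2 /\ p x y = 0.
Proof.
  destruct (smooth_on_elim _ _ p_smooth) as (pc & _ & p2 & _).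
  assert (A0 : Rabs 0 < r) by (rewrite Rabs_R0; lra).
  assert (A1 : Rabs (r / 2) < r) by (rewrite Rabs_pos_eq; lra).
  assert (A2 : Rabs (- (r / 2)) < r) by (rewrite Rabs_Ropp; auto).
  assert (P1 := implicit_increasing 0 0 (r / 2) A0 A0 A1 ltac:(lra)).
  assert (P2 := implicit_increasing 0 (- (r / 2)) 0 A0 A2 A0 ltac:(lra)).
  rewrite p0 in P1, P2.
  destruct (locally_2d_1d_const_y _ _ _ (continuity_2d_pt_pos p 0 _ (pc 0 (r / 2) (conj A0 A1)) P1)) as [d1 H1].
  destruct (locally_2d_1d_const_y _ _ _ (continuity_2d_pt_neg p 0 _ (pc 0 (- (r / 2)) (conj A0 A2)) P2)) as [d2 H2].
  assert (Hd : 0 < Rmin (r / 2) (Rmin d1 d2)) by (repeat apply Rmin_pos; try apply cond_pos; lra).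
  exists (Rmin (r / 2) (Rmin d1 d2)). split; [split; [auto|apply Rmin_l]|].
  intros x Hx.
  assert (M1 := Rmin_l (r / 2) (Rmin d1 d2)). assert (M2 := Rmin_r (r / 2) (Rmin d1 d2)).
  assert (M3 := Rmin_l d1 d2). assert (M4 := Rmin_r d1 d2).
  assert (Hx0 : Rabs (x - 0) < Rmin d1 d2) by (rewrite Rminus_0_r; lra).
  assert (Q1 : 0 < p x (r / 2)) by (apply H1; change (Rabs (x - 0) < d1); lra).
  assert (Q2 : p x (- (r / 2)) < 0) by (apply H2; change (Rabs (x - 0) < d2); lra).
  destruct (IVT_interv (p x) (- (r / 2)) (r / 2)) as [z [Hz Ez]]; auto; [|lra|].
  - intros t Ht. apply continuity_pt_filterlim.
    apply (@ex_derive_continuous R_AbsRing R_NormedModule). eexists. apply p2.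
    split; simpl; [lra|]. apply Rabs_lt_between. lra.
  - exists z. split; auto. apply Rabs_lt_between.
    assert (z <> r / 2) by (intros ->; lra). assert (z <> - (r / 2)) by (intros ->; lra). lra.
Qed.

Variables (y0 : R -> R) (d : R).
Hypothesis d_le : d <= r / 2.
Hypothesis y0_spec : forall x, Rabs x < d -> Rabs (y0 x) < r / 2 /\ p x (y0 x) = 0.

Lemma implicit_unique (x y : R) : Rabs x < d -> Rabs y < r -> p x y = 0 -> y = y0 x.
Proof.
  intros Hx Hy E. destruct (y0_spec x Hx) as [B E0].
  destruct (Rtotal_order y (y0 x)) as [H|[H|H]]; auto; exfalso.
  - assert (I := implicit_increasing x y (y0 x) ltac:(lra) ltac:(lra) ltac:(lra) ltac:(lra)). lra.
  - assert (I := implicit_increasing x (y0 x) y ltac:(lra) ltac:(lra) ltac:(lra) ltac:(lra)). lra.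
Qed.

(** The signs of p at y0(x) - h and y0(x) + h are opposite and persist for u near x; monotonicity
    then traps y0(u) between these two values. *)
Lemma implicit_continuous (x : R) (eps : posreal) :
  Rabs x < d -> locally x (fun u => Rabs u < d /\ Rabs (y0 u - y0 x) < eps).
Proof.
  intros Hx. destruct (y0_spec x Hx) as [B E].
  destruct (smooth_on_elim _ _ p_smooth) as (pc & _ & _).
  set (h := Rmin eps (r / 2 - Rabs (y0 x))).
  assert (Hh : 0 < h) by (apply Rmin_pos; [apply cond_pos|lra]).
  assert (M1 : h <= eps) by apply Rmin_l.
  assert (M2 : h <= r / 2 - Rabs (y0 x)) by apply Rmin_r.
  assert (B1 : Rabs (y0 x + h) < r) by (generalize (Rabs_triang (y0 x) h); rewrite (Rabs_pos_eq h); lra).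
  assert (B2 : Rabs (y0 x - h) < r)
    by (generalize (Rabs_triang (y0 x) (- h)); rewrite Rabs_Ropp, (Rabs_pos_eq h); unfold Rminus; lra).
  assert (P1 : 0 < p x (y0 x + h)) by (rewrite <- E; apply implicit_increasing; lra).
  assert (P2 : p x (y0 x - h) < 0) by (rewrite <- E; apply implicit_increasing; lra).
  assert (Hx' : Rabs x < r) by lra.
  assert (L1 := locally_2d_1d_const_y _ _ _ (continuity_2d_pt_pos p x _ (pc x _ (conj Hx' B1)) P1)).
  assert (L2 := locally_2d_1d_const_y _ _ _ (continuity_2d_pt_neg p x _ (pc x _ (conj Hx' B2)) P2)).
  assert (L3 : locally x (fun u => Rabs u < d)).
  { assert (Hd' : 0 < d - Rabs x) by lra. exists (mkposreal _ Hd'). intros u Hu.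
    exact (Rabs_lt_near u x d Hu). }
  generalize (filter_and _ _ (filter_and _ _ L1 L2) L3). apply filter_imp.
  intros u [[Q1 Q2] Hu]. split; auto. destruct (y0_spec u Hu) as [Bu Eu].
  assert (Hu' : Rabs u < r) by lra.
  apply Rlt_le_trans with h; auto. apply Rabs_lt_between'. split.
  - apply Rnot_le_lt. intros [H|H].
    + assert (I := implicit_increasing u (y0 u) (y0 x - h) ltac:(lra) ltac:(lra) ltac:(lra) ltac:(lra)). lra.
    + rewrite H in Eu. lra.
  - apply Rnot_le_lt. intros [H|H].
    + assert (I := implicit_increasing u (y0 x + h) (y0 u) ltac:(lra) ltac:(lra) ltac:(lra) ltac:(lra)). lra.
    + rewrite <- H in Eu. lra.
Qed.

(** With k the increment of y0 over h, differentiability of p gives a h + b k = o(max(|h|, |k|)). A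
    preliminary bound |k| <= K |h| turns the error into o(h). *)
Lemma implicit_derive (x : R) :
  Rabs x < d -> is_derive y0 x (- (Dx p x (y0 x) / Dy p x (y0 x))).
Proof.
  intros Hx. destruct (y0_spec x Hx) as [B E].
  assert (HR : rect r r (x, y0 x)) by (split; simpl; lra).
  assert (HP := py_pos _ _ HR).
  assert (HD := diff_on_differentiable _ (open_rect r r) 0 p x (y0 x)
                  (proj1 (smooth_on_diff_on _ _) p_smooth 1%nat) HR).
  set (a := Dx p x (y0 x)) in *. set (b := Dy p x (y0 x)) in *.
  (* If |k| > |h| and the error is at most (b/2)|k|, then b|k| <= |a||h| + (b/2)|k|, so |k| <=
     (2|a|/b)|h|. The summand 1 covers |k| <= |h|. *)
  set (K := 1 + 2 * Rabs a / b).
  assert (HK : 0 <= 2 * Rabs a / b)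
    by (apply Rmult_le_pos; [generalize (Rabs_pos a); lra|left; now apply Rinv_0_lt_compat]).
  assert (HK1 : 1 <= K) by (unfold K; lra).
  apply is_derive_Reals. intros eps Heps.
  (* The bound b/2 serves the preliminary estimate of k; the bound eps b/(2K) makes the final error
     at most eps/2. *)
  assert (He : 0 < Rmin (b / 2) (eps * b / (2 * K))).
  { apply Rmin_pos; [lra|]. apply Rdiv_lt_0_compat; [now apply Rmult_lt_0_compat|lra]. }
  destruct (HD (mkposreal _ He)) as [d1 Hd1].
  destruct (implicit_continuous x d1 Hx) as [d2 Hd2].
  assert (Hd : 0 < Rmin d1 d2) by (apply Rmin_pos; apply cond_pos).
  exists (mkposreal _ Hd). intros h Hh Hhd. simpl in Hhd.
  assert (M1 := Rmin_l d1 d2). assert (M2 := Rmin_r d1 d2).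
  destruct (Hd2 (x + h)) as [Hxh Hyh].
  { change (Rabs (x + h - x) < d2). replace (x + h - x) with h by ring. lra. }
  assert (HH := Hd1 (x + h) (y0 (x + h))).
  replace (x + h - x) with h in HH by ring.
  specialize (HH ltac:(lra) Hyh). simpl in HH.
  rewrite E, (proj2 (y0_spec _ Hxh)) in HH.
  set (k := y0 (x + h) - y0 x) in *.
  replace (0 - 0 - (a * h + b * k)) with (- (a * h + b * k)) in HH by ring.
  rewrite Rabs_Ropp in HH.
  set (e1 := Rmin (b / 2) (eps * b / (2 * K))) in *.
  assert (E1 : e1 <= b / 2) by apply Rmin_l.
  assert (E2 : e1 <= eps * b / (2 * K)) by apply Rmin_r.
  assert (Hh0 : 0 < Rabs h) by now apply Rabs_pos_lt.
  assert (HM : Rmax (Rabs h) (Rabs k) <= K * Rabs h).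
  { apply Rmax_lub; [nra|]. destruct (Rle_dec (Rabs k) (Rabs h)) as [Hk|Hk]; [nra|].
    rewrite Rmax_right in HH by lra.
    assert (T : b * Rabs k <= Rabs (a * h + b * k) + Rabs a * Rabs h).
    { rewrite <- (Rabs_pos_eq b) at 1 by lra. rewrite <- !Rabs_mult.
      replace (b * k) with ((a * h + b * k) + - (a * h)) at 1 by ring.
      eapply Rle_trans; [apply Rabs_triang|]. rewrite Rabs_Ropp. lra. }
    assert (T2 : b / 2 * Rabs k <= Rabs a * Rabs h) by nra.
    unfold K. apply Rmult_le_reg_l with (b / 2); [lra|].
    replace (b / 2 * ((1 + 2 * Rabs a / b) * Rabs h)) with (b / 2 * Rabs h + Rabs a * Rabs h) by (field; lra).
    nra. }
  replace (k / h - - (a / b)) with ((a * h + b * k) / (b * h)) by (field; lra).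
  unfold Rdiv. rewrite Rabs_mult, Rabs_inv, Rabs_mult, (Rabs_pos_eq b) by lra.
  assert (Hbh : 0 < b * Rabs h) by now apply Rmult_lt_0_compat.
  apply Rmult_lt_reg_r with (b * Rabs h); auto. rewrite Rmult_assoc, Rinv_l, Rmult_1_r by lra.
  apply Rle_lt_trans with (eps * b / (2 * K) * (K * Rabs h)).
  - eapply Rle_trans; [exact HH|]. apply Rmult_le_compat; auto; [lra|].
    apply Rle_trans with (Rabs h); [lra|apply Rmax_l].
  - replace (eps * b / (2 * K) * (K * Rabs h)) with (eps * (b * Rabs h) / 2) by (field; lra).
    assert (0 < eps * (b * Rabs h)) by now apply Rmult_lt_0_compat. lra.
Qed.

(** Bootstrapping: the formula for y0' contains only y0 and derivatives of p, so y0 of class C^n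
    makes y0' of class C^n. A function of x is viewed as constant in y, hence the arbitrary height
    [c]. *)
Lemma implicit_smooth (c : R) : smooth_on (rect d c) (fun x _ => y0 x).
Proof.
  destruct (smooth_on_elim _ _ p_smooth) as (_ & _ & _ & Sx & Sy).
  assert (Cx := proj1 (smooth_on_diff_on _ _) Sx). assert (Cy := proj1 (smooth_on_diff_on _ _) Sy).
  assert (HR : forall x y, rect d c (x, y) -> rect r r (x, y0 x)).
  { intros x y [Hx _]. simpl in Hx. destruct (y0_spec x Hx). split; simpl; lra. }
  assert (HC : forall x y, rect d c (x, y) -> continuity_2d_pt (fun x _ => y0 x) x y).
  { intros x y [Hx _] eps. destruct (implicit_continuous x eps Hx) as [d1 Hd1].
    exists d1. intros u v Hu _. now apply Hd1. }
  apply smooth_on_diff_on. induction n.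
  - intros x y Hxy. split; auto.
  - apply diff_on_intro with (fx := fun x y => - (Dx p x (y0 x) / Dy p x (y0 x))) (fy := fun _ _ => 0); auto.
    + apply open_rect.
    + intros x y [Hx _]. now apply implicit_derive.
    + intros x y _. apply @is_derive_const.
    + apply diff_on_opp; [apply open_rect|]. apply diff_on_div; [apply open_rect| | |].
      * intros x y Hxy. apply Rgt_not_eq, py_pos. eapply HR; eauto.
      * apply (diff_on_comp _ (rect r r) n (Dx p) (fun x _ => x) (fun x _ => y0 x)); auto using open_rect, diff_on_fst.
      * apply (diff_on_comp _ (rect r r) n (Dy p) (fun x _ => x) (fun x _ => y0 x)); auto using open_rect, diff_on_fst.
    + apply diff_on_const, open_rect.
Qed.

End ImplicitFunction.

Lemma implicit_function (p : R -> R -> R) (r : R) :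
  0 < r -> smooth_on (rect r r) p -> p 0 0 = 0 ->
  (forall x y, rect r r (x, y) -> 0 < Dy p x y) ->
  exists d y0, 0 < d <= r / 2 /\ y0 0 = 0 /\
    (forall x, Rabs x < d -> Rabs (y0 x) < r / 2 /\ p x (y0 x) = 0) /\
    forall c, smooth_on (rect d c) (fun x _ => y0 x).
Proof.
  intros Hr Hp p0 Hpos. destruct (implicit_exists p r Hr Hp p0 Hpos) as [d [Hd Hex]].
  (* A zero is chosen for each x separately. Uniqueness gives y0 0 = 0 and makes the choice coherent
     for |x| < d; elsewhere the value is irrelevant. *)
  set (y0 := fun x => epsilon (inhabits 0) (fun y => Rabs y < r / 2 /\ p x y = 0)).
  assert (H0 : forall x, Rabs x < d -> Rabs (y0 x) < r / 2 /\ p x (y0 x) = 0)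
    by (intros x Hx; apply (epsilon_spec (inhabits 0) _ (Hex x Hx))).
  exists d, y0. split; [|split; [|split]]; auto.
  - symmetry. apply (implicit_unique p r) with (d := d); auto; rewrite ?Rabs_R0; tauto || lra.
  - intros c. apply (implicit_smooth p r); auto. lra.
Qed.

(** * Morse's lemma and the equation h = h'^2 *)

Lemma locally_2d_origin_rect (P : R -> R -> Prop) (r : R) :
  0 < r -> locally_2d P 0 0 ->
  exists d, 0 < d <= r /\ forall x y, rect d d (x, y) -> P x y.
Proof.
  intros Hr [d Hd]. exists (Rmin r d).
  assert (M1 := Rmin_l r d). assert (M2 := Rmin_r r d).
  split; [split; [apply Rmin_pos; [auto|apply cond_pos]|auto]|].
  intros x y [Hx Hy]; simpl in *. apply Hd; rewrite Rminus_0_r; lra.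
Qed.

Lemma rect_origin (a b : R) : 0 < a -> 0 < b -> rect a b (0, 0).
Proof. intros Ha Hb. split; simpl; now rewrite Rabs_R0. Qed.

Lemma smooth_on_comp (U V : R * R -> Prop) (f a b : R -> R -> R) :
  open U -> open V -> (forall x y, U (x, y) -> V (a x y, b x y)) ->
  smooth_on V f -> smooth_on U a -> smooth_on U b ->
  smooth_on U (fun x y => f (a x y) (b x y)).
Proof.
  intros HU HV HUV Hf Ha Hb. apply smooth_on_diff_on. intros n.
  apply (diff_on_comp U V); auto; now apply smooth_on_diff_on.
Qed.

Lemma Dy_scal (f : R -> R -> R) (s x y : R) : Dy (fun x y => s * f x y) x y = s * Dy f x y.
Proof. exact (Derive_scal (f x) s y). Qed.

Lemma Dy_shift (V : R * R -> Prop) (f : R -> R -> R) (c : R -> R) (x z : R) :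
  smooth_on V f -> V (x, c x + z) -> Dy (fun x z => f x (c x + z)) x z = Dy f x (c x + z).
Proof.
  intros Hf HV. destruct (smooth_on_elim _ _ Hf) as (_ & _ & f2 & _).
  apply is_derive_unique. rewrite <- (Rmult_1_l (Dy f x (c x + z))).
  apply (is_derive_comp (fun t => f x t) (fun t => c x + t)); [now apply f2|].
  auto_derive; auto.
Qed.

(* Morse's lemma with the parameter [x]: [y0 x] is the critical point of [g x], and dividing
   [g x y - g x (y0 x)] twice by [y - y0 x] leaves a non-vanishing function. *)
Lemma morse_with_parameter (g : R -> R -> R) (r s : R) :
  0 < r -> smooth_on (rect r r) g -> s * s = 1 -> Dy g 0 0 = 0 -> 0 < s * Dy (Dy g) 0 0 ->
  exists d y0 yt, 0 < d <= r /\ y0 0 = 0 /\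
    (forall x, Rabs x < d -> Rabs (y0 x) < r /\ Dy g x (y0 x) = 0) /\
    smooth_on (rect d d) (fun x _ => y0 x) /\
    second_coordinate_change (rect d d) yt /\
    forall x y, rect d d (x, y) -> g x y = g x (y0 x) + s * yt x y ^ 2.
Proof.
  intros Hr Hg Hs Hg1 Hg2.
  destruct (smooth_on_elim _ _ Hg) as (_ & _ & _ & _ & Sgy).
  destruct (smooth_on_elim _ _ Sgy) as (_ & _ & _ & _ & Sgyy).
  destruct (locally_2d_origin_rect (fun x y => 0 < s * Dy (Dy g) x y) r Hr) as [r1 [Hr1 Hpos]].
  { apply (continuity_2d_pt_pos (fun x y => s * Dy (Dy g) x y)); auto.
    apply continuity_2d_pt_mult; [apply continuity_2d_pt_const|].
    apply (smooth_on_elim _ _ Sgyy), rect_origin; auto. }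
  assert (Hsub : forall x y, rect r1 r1 (x, y) -> rect r r (x, y))
    by (intros x y [Hx Hy]; split; simpl in *; lra).
  (* The factor [s] makes the derivative in y positive for either sign of g_yy. *)
  destruct (implicit_function (fun x y => s * Dy g x y) r1) as (d1 & y0 & Hd1 & y00 & Hy0 & Sy0); try lra.
  { apply smooth_on_diff_on. intros n. apply diff_on_mult; [|apply diff_on_const|]; try apply open_rect.
    apply smooth_on_diff_on, (smooth_on_subset (rect r r)); auto. }
  { rewrite Hg1. ring. }
  { intros x y Hxy. rewrite Dy_scal. auto. }
  assert (Hcrit : forall x, Rabs x < d1 -> Dy g x (y0 x) = 0).
  { intros x Hx. destruct (Hy0 x Hx) as [_ E].
    rewrite <- (Rmult_1_l (Dy g x (y0 x))), <- Hs, Rmult_assoc, E. ring. }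
  (* The shift moves the critical points to the axis z = 0, where Hadamard's division applies. *)
  set (G := fun x z => g x (y0 x + z)).
  assert (HV : forall x z, rect d1 (r1 / 2) (x, z) -> rect r r (x, y0 x + z)).
  { intros x z [Hx Hz]; simpl in *. destruct (Hy0 x Hx). split; simpl; [lra|].
    eapply Rle_lt_trans; [apply Rabs_triang|lra]. }
  assert (SG : smooth_on (rect d1 (r1 / 2)) G).
  { apply (smooth_on_comp _ (rect r r) g (fun x _ => x) (fun x z => y0 x + z)); auto using open_rect;
      apply smooth_on_diff_on; intros n.
    - apply diff_on_fst, open_rect.
    - apply diff_on_plus; [apply open_rect| |apply diff_on_snd, open_rect].
      apply smooth_on_diff_on, Sy0. }
  assert (DG : forall x z, rect d1 (r1 / 2) (x, z) -> Dy G x z = Dy g x (y0 x + z)).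
  { intros x z Hxz. apply (Dy_shift (rect r r)); auto. }
  destruct (smooth_on_elim _ _ SG) as (_ & _ & _ & _ & SGy).
  set (H := moment 0 (Dy G)).
  assert (SH : smooth_on (rect d1 (r1 / 2)) H).
  { apply smooth_on_diff_on. intros n. now apply diff_on_moment, smooth_on_diff_on. }
  destruct (smooth_on_elim _ _ SH) as (_ & _ & _ & _ & SHy).
  set (q := moment 0 (Dy H)).
  assert (Sq : smooth_on (rect d1 (r1 / 2)) q).
  { apply smooth_on_diff_on. intros n. now apply diff_on_moment, smooth_on_diff_on. }
  assert (EG : forall x z, rect d1 (r1 / 2) (x, z) -> G x z = g x (y0 x) + z ^ 2 * q x z).
  { intros x z Hxz.
    assert (Hx0 : rect d1 (r1 / 2) (x, 0)) by (split; [apply Hxz|simpl; rewrite Rabs_R0; lra]).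
    rewrite (hadamard d1 (r1 / 2) G); auto; [|now apply smooth_on_diff_on].
    fold H. rewrite (hadamard d1 (r1 / 2) H); auto; [|now apply smooth_on_diff_on].
    (* H(x, 0) = G_z(x, 0) = g_y(x, y0(x)) = 0, so the second division has no constant term and G(x,
       z) - G(x, 0) = z^2 q. *)
    unfold H at 1. rewrite moment_axis, DG, Rplus_0_r, Hcrit; auto; [|apply Hxz].
    fold q. unfold G. rewrite Rplus_0_r. simpl. field. }
  assert (O1 : rect d1 (r1 / 2) (0, 0)) by (apply rect_origin; lra).
  (* q(0, 0) = H_z(0, 0) = g_yy(0, 0)/2, the factor 1/2 being the integral of t over [0, 1]. *)
  assert (Q0 : 0 < s * q 0 0).
  { unfold q. rewrite moment_axis.
    replace (Dy H 0 0) with (moment 1 (Dy (Dy G)) 0 0)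
      by (symmetry; apply is_derive_unique, (is_derive_moment_y d1 (r1 / 2)); auto;
          now apply smooth_on_diff_on).
    rewrite moment_axis.
    rewrite (Dy_ext_on _ _ (fun x z => Dy g x (y0 x + z)) 0 0 (open_rect _ _) DG O1).
    rewrite (Dy_shift (rect r r)), y00, Rplus_0_r; auto. simpl. lra. }
  destruct (locally_2d_origin_rect (fun x z => 0 < s * q x z) (Rmin d1 (r1 / 2))) as [r2 [Hr2 Hq]].
  { apply Rmin_pos; lra. }
  { apply (continuity_2d_pt_pos (fun x y => s * q x y)); auto.
    apply continuity_2d_pt_mult; [apply continuity_2d_pt_const|]. now apply (smooth_on_elim _ _ Sq). }
  assert (M1 := Rmin_l d1 (r1 / 2)). assert (M2 := Rmin_r d1 (r1 / 2)).
  assert (Sz : forall d, d <= d1 -> smooth_on (rect d d) (fun x y => y - y0 x)).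
  { intros d Hd. apply (smooth_on_subset (rect d1 d)).
    - intros x y [Hx Hy]. simpl in *. split; simpl; lra.
    - apply smooth_on_diff_on. intros n. apply diff_on_minus; [apply open_rect|apply diff_on_snd, open_rect|].
      apply smooth_on_diff_on, Sy0. }
  destruct (locally_2d_origin_rect (fun x y => Rabs (y - y0 x) < r2) r2) as [d2 [Hd2 Hz]]; [lra| |].
  { destruct (smooth_on_elim _ _ (Sz d1 (Rle_refl d1))) as (c & _).
    assert (P : 0 < r2) by lra.
    generalize (c 0 0 (rect_origin d1 d1 ltac:(lra) ltac:(lra)) (mkposreal _ P)).
    apply locally_2d_impl, locally_2d_forall. intros u v Huv. simpl in Huv.
    rewrite y00, !Rminus_0_r in Huv. auto. }
  assert (Hxz : forall x y, rect d2 d2 (x, y) -> rect r2 r2 (x, y - y0 x)).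
  { intros x y Hxy. split; simpl; [|now apply Hz]. destruct Hxy as [Hx _]. simpl in Hx. lra. }
  assert (Sub2 : forall x z, rect r2 r2 (x, z) -> rect d1 (r1 / 2) (x, z)).
  { intros x z [Hx Hz']; split; simpl in *; lra. }
  (* With z = y - y0(x) and yt = z sqrt(s q), one gets s yt^2 = s^2 z^2 q = z^2 q. *)
  set (S := fun x y => sqrt (s * q x (y - y0 x))).
  set (yt := fun x y => (y - y0 x) * S x y).
  assert (SS : smooth_on (rect d2 d2) S).
  { apply smooth_on_diff_on. intros n. apply diff_on_sqrt; [apply open_rect| |].
    - intros x y Hxy. now apply Hq, Hxz.
    - apply diff_on_mult; [apply open_rect|apply diff_on_const, open_rect|].
      apply (smooth_on_diff_on _ (fun x y => q x (y - y0 x))).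
      apply (smooth_on_comp _ (rect d1 (r1 / 2)) q (fun x _ => x) (fun x y => y - y0 x)); auto using open_rect.
      + apply smooth_on_diff_on. intros m. apply diff_on_fst, open_rect.
      + apply Sz. lra. }
  assert (Syt : smooth_on (rect d2 d2) yt).
  { apply smooth_on_diff_on. intros n. apply diff_on_mult; [apply open_rect| |].
    - apply smooth_on_diff_on, Sz. lra.
    - now apply smooth_on_diff_on. }
  assert (O2 : rect d2 d2 (0, 0)) by (apply rect_origin; lra).
  assert (Dyt : Dy yt 0 0 <> 0).
  { destruct (smooth_on_elim _ _ SS) as (_ & _ & S2 & _).
    replace (Dy yt 0 0) with (S 0 0).
    - apply Rgt_not_eq, sqrt_lt_R0. rewrite y00, Rminus_0_r. auto.
    - symmetry. apply is_derive_unique.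
      (* In the product rule the derivative of [S] is multiplied by 0 - y0(0) = 0. *)
      replace (S 0 0) with (1 * S 0 0 + (0 - y0 0) * Dy S 0 0) by (rewrite y00; ring).
      apply (is_derive_mult_R (fun t => t - y0 0) (S 0)); [auto_derive; auto; ring|now apply S2]. }
  destruct (smooth_on_elim _ _ Syt) as (_ & _ & _ & _ & Syty).
  destruct (locally_2d_origin_rect (fun x y => Dy yt x y <> 0) d2) as [d [Hd Hnz]]; [lra| |].
  { apply continuity_2d_pt_neq_0; auto. now apply (smooth_on_elim _ _ Syty). }
  assert (Sub3 : forall x y, rect d d (x, y) -> rect d2 d2 (x, y)).
  { intros x y [Hx Hy]; split; simpl in *; lra. }
  exists d, y0, yt. split; [lra|]. split; [auto|]. split; [|split; [|split; [split; auto|]]].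
  - intros x Hx. destruct (Hy0 x ltac:(lra)). split; [lra|apply Hcrit; lra].
  - apply (smooth_on_subset (rect d1 d)); [|apply Sy0].
    intros x y [Hx Hy]; split; simpl in *; lra.
  - now apply (smooth_on_subset (rect d2 d2)).
  - intros x y Hxy. apply Sub3, Hxz in Hxy.
    transitivity (G x (y - y0 x)); [unfold G; f_equal; ring|].
    rewrite EG; auto. unfold yt, S. rewrite Rpow_mult_distr, pow2_sqrt.
    + f_equal. transitivity (s * s * ((y - y0 x) ^ 2 * q x (y - y0 x))); [rewrite Hs; ring|ring].
    + left. now apply Hq.
Qed.

Lemma null_derivative_constant (f : R -> R) (d x : R) :
  (forall x, Rabs x < d -> is_derive f x 0) -> Rabs x < d -> f x = f 0.
Proof.
  intros Hf Hx.
  assert (HR : forall t, Rmin 0 x <= t <= Rmax 0 x -> Rabs t < d).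
  { intros t Ht. apply Rabs_lt_between in Hx. apply Rabs_lt_between.
    revert Ht. unfold Rmin, Rmax. destruct (Rle_dec 0 x); lra. }
  destruct (MVT_gen f 0 x (fun _ => 0)) as [c [_ E]].
  - intros t Ht. apply Hf, HR. lra.
  - intros t Ht. apply continuity_pt_filterlim.
    apply (@ex_derive_continuous R_AbsRing R_NormedModule). eexists. apply Hf, HR, Ht.
  - lra.
Qed.

(* Differentiating [h = h1 ^ 2] gives [h1 (2 h2 - 1) = 0], so the continuous function [h2]
   takes values in [{0, 1/2}] and is constant. *)
Lemma clairaut_equation (h h1 h2 : R -> R) (d : R) :
  0 < d ->
  (forall x, Rabs x < d -> is_derive h x (h1 x)) ->
  (forall x, Rabs x < d -> is_derive h1 x (h2 x)) ->
  (forall x, Rabs x < d -> continuous h2 x) ->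
  (forall x, Rabs x < d -> h x = h1 x ^ 2) -> h 0 = 0 ->
  exists k, (k = 1 \/ k = 0) /\ forall x, Rabs x < d -> h x = k * x ^ 2 / 4.
Proof.
  intros Hd D1 D2 C E E0.
  assert (L : forall x, Rabs x < d -> locally x (fun u => Rabs u < d)).
  { intros x Hx. assert (Hp : 0 < d - Rabs x) by lra. exists (mkposreal _ Hp).
    intros u Hu. exact (Rabs_lt_near u x d Hu). }
  assert (A : forall x, Rabs x < d -> h1 x = 2 * h1 x * h2 x).
  { intros x Hx. transitivity (Derive h x); [symmetry; now apply is_derive_unique, D1|].
    rewrite (Derive_ext_loc h (fun t => h1 t * h1 t)).
    - apply is_derive_unique. replace (2 * h1 x * h2 x) with (h2 x * h1 x + h1 x * h2 x) by ring.
      apply is_derive_mult_R; auto.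
    - generalize (L x Hx). apply filter_imp. intros u Hu. rewrite E; auto. ring. }
  assert (V : forall x, Rabs x < d -> h2 x = 0 \/ h2 x = 1 / 2).
  { intros x Hx. destruct (Req_dec (h2 x) (1 / 2)) as [|Hne]; [now right|left].
    transitivity (Derive h1 x); [symmetry; now apply is_derive_unique, D2|].
    transitivity (Derive (fun _ => 0) x); [|apply Derive_const].
    apply Derive_ext_loc.
    (* By continuity h2 avoids 1/2 near x, so h1 vanishes on a whole neighbourhood and its
       derivative h2 is 0 at x. *)
    assert (LN : locally x (fun u => h2 u <> 1 / 2)).
    { apply (C x Hx (fun v => v <> 1 / 2)), (open_neq (1 / 2)). auto. }
    generalize (filter_and _ _ LN (L x Hx)). apply filter_imp. intros u [Hu1 Hu2].
    assert (Au := A u Hu2).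
    destruct (Rmult_integral (h1 u) (h2 u - 1 / 2)); lra. }
  assert (K : forall x, Rabs x < d -> h2 x = h2 0).
  { intros x Hx. apply null_derivative_constant with d; auto. clear x Hx. intros x Hx.
    apply is_derive_ext_loc with (fun _ => h2 x); [|apply @is_derive_const].
    (* A variation below 1/4 cannot bridge the gap 1/2 between the two possible values, so h2 is
       locally constant. *)
    assert (Hp : 0 < 1 / 4) by lra.
    assert (LB := proj1 (filterlim_locally _ _) (C x Hx) (mkposreal _ Hp)).
    generalize (filter_and _ _ LB (L x Hx)). apply filter_imp. intros u [Hu1 Hu2].
    change (Rabs (h2 u - h2 x) < 1 / 4) in Hu1. apply Rabs_lt_between in Hu1.
    destruct (V u Hu2), (V x Hx); lra. }
  assert (O : Rabs 0 < d) by now rewrite Rabs_R0.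
  assert (H10 : h1 0 = 0) by (apply (Rsqr_0_uniq (h1 0)); unfold Rsqr; rewrite E in E0; auto; lra).
  assert (F : forall x, Rabs x < d -> h1 x = h2 0 * x).
  { intros x Hx. assert (Z := null_derivative_constant (fun t => h1 t - h2 0 * t) d x).
    simpl in Z. rewrite H10 in Z. apply Rminus_diag_uniq. rewrite Z; auto; [ring|].
    intros t Ht. generalize (K t Ht). generalize (h2 0). intros c <-.
    rewrite <- (Rminus_diag (h2 t)).
    apply @is_derive_minus; [auto|]. auto_derive; auto. ring. }
  (* Here h1 = h2(0) x, so h = h2(0)^2 x^2; writing this as k x^2/4 gives k = 4 h2(0)^2, which is 0
     or 1. *)
  exists (4 * h2 0 ^ 2). split.
  - destruct (V 0 O) as [-> | ->]; [right|left]; field.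
  - intros x Hx. rewrite E, F; auto. field.
Qed.

Lemma admissible_normal_form (g : R -> R -> R) (W : R * R -> Prop) :
  nbhd_origin W -> smooth_on W g ->
  g 0 0 = 0 -> Dy g 0 0 = 0 -> Dy (Dy g) 0 0 <> 0 ->
  admissible_discriminant g ->
  exists d yt s k, 0 < d /\ second_coordinate_change (rect d d) yt /\
    (s = 1 \/ s = -1) /\ (k = 1 \/ k = 0) /\
    forall x y, rect d d (x, y) -> g x y = s * yt x y ^ 2 + k * x ^ 2 / 4.
Proof.
  intros [HW W0] Hg g0 gy0 gyy0 (U & [HU U0] & L & HL).
  apply nijenhuis_with_discriminant_iff in HL; auto. destruct HL as [_ HL].
  destruct (open_contains_rect (fun p => U p /\ W p)) as [r [Hr HUW]].
  { split; [now apply open_and|auto]. }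
  assert (Hgr : smooth_on (rect r r) g) by (apply (smooth_on_subset W); auto; intros; now apply HUW).
  assert (Es : exists s, (s = 1 \/ s = -1) /\ 0 < s * Dy (Dy g) 0 0).
  { destruct (Rlt_dec 0 (Dy (Dy g) 0 0)); [exists 1|exists (-1)]; split; auto; lra. }
  destruct Es as [s [Hs Hpos]].
  destruct (morse_with_parameter g r s) as (d & y0 & yt & Hd & y00 & Hy0 & Sy0 & Hyt & Eg); auto.
  { destruct Hs as [-> | ->]; ring. }
  destruct (smooth_on_elim _ _ Hgr) as (_ & _ & _ & Sgx & _).
  (* The candidate for h', again as a function constant in y; its partial derivative in x, read at y
     = 0, serves as h''. *)
  assert (SF : smooth_on (rect d d) (fun x _ => Dx g x (y0 x))).
  { apply (smooth_on_comp _ (rect r r) (Dx g) (fun x _ => x) (fun x _ => y0 x)); auto using open_rect.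
    - intros x y [Hx _]. simpl in Hx. destruct (Hy0 x Hx). split; simpl; lra.
    - apply smooth_on_diff_on. intros n. apply diff_on_fst, open_rect. }
  destruct (smooth_on_elim _ _ SF) as (_ & F1 & _ & SFx & _).
  destruct (smooth_on_elim _ _ SFx) as (CF & _).
  destruct (smooth_on_elim _ _ Sy0) as (_ & Y1 & _).
  assert (O : forall x, Rabs x < d -> rect d d (x, 0)).
  { intros x Hx. split; simpl; auto. rewrite Rabs_R0. lra. }
  destruct (clairaut_equation (fun x => g x (y0 x)) (fun x => Dx g x (y0 x))
             (fun x => Dx (fun x _ => Dx g x (y0 x)) x 0) d) as [k [Hk Eh]].
  - lra.
  - intros x Hx. destruct (Hy0 x Hx) as [B C].
    (* The term g_y y0', zero on the critical curve, is restored to match the chain rule. *)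
    replace (Dx g x (y0 x)) with
      (Dx g x (y0 x) * 1 + Dy g x (y0 x) * Dx (fun x _ => y0 x) x 0) by (rewrite C; ring).
    apply is_derive_Reals. apply (derivable_pt_lim_comp_2d g (fun x => x) y0).
    + apply (diff_on_differentiable (rect r r) (open_rect r r) 0); [now apply smooth_on_diff_on|].
      split; simpl; lra.
    + apply derivable_pt_lim_id.
    + apply is_derive_Reals. now apply (Y1 x 0), O.
  - intros x Hx. now apply (F1 x 0), O.
  - intros x Hx. apply continuity_pt_filterlim. intros eps Heps.
    destruct (locally_2d_1d_const_y _ x 0 (CF x 0 (O x Hx) (mkposreal eps Heps))) as [d1 Hd1].
    exists d1. split; [apply cond_pos|]. intros z [_ Hz]. now apply Hd1.
  - intros x Hx. destruct (Hy0 x Hx) as [B C].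
    destruct (HL x (y0 x)) as (_ & _ & _ & E).
    + apply HUW. split; simpl; lra.
    + rewrite C in E. lra.
  - now rewrite y00.
  - exists d, yt, s, k. split; [lra|]. repeat split; auto; try apply Hyt.
    intros x y Hxy. rewrite (Eg x y Hxy), (Eh x) by apply Hxy. ring.
Qed.

Lemma normal_form_admissible (U : R * R -> Prop) (g yt : R -> R -> R) (s k : R) :
  nbhd_origin U -> second_coordinate_change U yt -> s * s = 1 -> k * k = k ->
  (forall x y, U (x, y) -> g x y = s * yt x y ^ 2 + k * x ^ 2 / 4) ->
  admissible_discriminant g.
Proof.
  intros HU Hyt Hs Hk Eg. exists U. split; auto.
  (* The normal operator carried back to (x, y): the entries are x/2 + g_x, g_y, the quotient of t/2
     - p (k x + 2 s t p) by q, and x/2 - g_x. *)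
  exists (fun x y => let t := yt x y in let p := Dx yt x y in let q := Dy yt x y in
    Mat2 (x / 2 + k * x / 2 + 2 * s * t * p) (2 * s * t * q)
         ((t / 2 - p * (k * x + 2 * s * t * p)) / q) (x / 2 - k * x / 2 - 2 * s * t * p)).
  apply (operator_in_normal_coordinates U g yt s k); auto; [apply HU|].
  intros x y Hxy. assert (Hq := proj2 Hyt x y Hxy).
  rewrite matrix_in_coords_fst; auto. simpl. f_equal; field; auto.
Qed.

Theorem theorem3p7 (g : R -> R -> R)
  (g_smooth : exists W : R * R -> Prop, nbhd_origin W /\ smooth_on W g)
  (g0 : g 0 0 = 0) (gy0 : Dy g 0 0 = 0) (gyy0 : Dy (Dy g) 0 0 <> 0) :
  (admissible_discriminant g <->
   exists (U : R * R -> Prop) (yt : R -> R -> R) (s : R),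
     nbhd_origin U /\ second_coordinate_change U yt /\ (s = 1 \/ s = -1) /\
     ((forall x y : R, U (x, y) -> g x y = normal_form1 s x (yt x y)) \/
      (forall x y : R, U (x, y) -> g x y = normal_form2 s x (yt x y))))
  /\
  (forall (U : R * R -> Prop) (yt : R -> R -> R) (s : R),
     nbhd_origin U -> second_coordinate_change U yt -> (s = 1 \/ s = -1) ->
     ((forall x y : R, U (x, y) -> g x y = normal_form1 s x (yt x y)) ->
      forall L : tensor11,
        nijenhuis_with_discriminant U g L <->
        (forall x y : R, U (x, y) ->
           matrix_in_coords (fun a _ => a) yt L x y = normal_op1 s x (yt x y)))
     /\
     ((forall x y : R, U (x, y) -> g x y = normal_form2 s x (yt x y)) ->
      forall L : tensor11,
        nijenhuis_with_discriminant U g L <->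
        (forall x y : R, U (x, y) ->
           matrix_in_coords (fun a _ => a) yt L x y = normal_op2 s x (yt x y)))).
Proof.
  assert (Sq : forall s, s = 1 \/ s = -1 -> s * s = 1) by (intros s [-> | ->]; ring).
  (* The two forms and their operators are brought to the common shape with k = 1 and k = 0. *)
  assert (N1 : forall s x t, normal_form1 s x t = s * t ^ 2 + 1 * x ^ 2 / 4)
    by (intros; unfold normal_form1; field).
  assert (N2 : forall s x t, normal_form2 s x t = s * t ^ 2 + 0 * x ^ 2 / 4)
    by (intros; unfold normal_form2; field).
  assert (O1 : forall s x t,
    normal_op1 s x t = Mat2 (x / 2 + 1 * x / 2) (s * (2 * t)) (t / 2) (x / 2 - 1 * x / 2))
    by (intros; unfold normal_op1; f_equal; field).
  assert (O2 : forall s x t,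
    normal_op2 s x t = Mat2 (x / 2 + 0 * x / 2) (s * (2 * t)) (t / 2) (x / 2 - 0 * x / 2))
    by (intros; unfold normal_op2; f_equal; field).
  split; [split|].
  - intros HA. destruct g_smooth as (W & HW & Hg).
    destruct (admissible_normal_form g W) as (d & yt & s & k & Hd & Hyt & Hs & Hk & Eg); auto.
    exists (rect d d), yt, s.
    split; [split; [apply open_rect|now apply rect_origin]|]. split; [auto|]. split; [auto|].
    destruct Hk as [-> | ->]; [left|right]; intros x y Hxy; rewrite ?N1, ?N2; auto.
  - intros (U & yt & s & HU & Hyt & Hs & [Eg | Eg]).
    + apply (normal_form_admissible U g yt s 1); auto using Rmult_1_l, Rmult_0_l.
      intros x y Hxy. rewrite <- N1. auto.
    + apply (normal_form_admissible U g yt s 0); auto using Rmult_1_l, Rmult_0_l.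
      intros x y Hxy. rewrite <- N2. auto.
  - intros U yt s [HU U0] Hyt Hs. split; intros Eg L.
    + rewrite (operator_in_normal_coordinates U g yt s 1); auto using Rmult_1_l, Rmult_0_l.
      * split; intros H x y Hxy; [rewrite O1|rewrite <- O1]; auto.
      * intros x y Hxy. rewrite <- N1. auto.
    + rewrite (operator_in_normal_coordinates U g yt s 0); auto using Rmult_1_l, Rmult_0_l.
      * split; intros H x y Hxy; [rewrite O2|rewrite <- O2]; auto.
      * intros x y Hxy. rewrite <- N2. auto.
Qed.
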